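(* Fix $\alpha>0$. Let $c>0$ be a sufficiently small constant. Then there are a constant $c'>0$ depending on $c$ and $\alpha$, and an implied constant not depending on $n,p,d,\xi$, such that the following holds. Let $n\ge 1$ and $d$ be integers with $0\le d\le n^{c}$, let $p$ be a prime with $p\le \exp(n^{c})$, and let $M$ be a random $n\times n$ matrix whose entries are iid copies of an $\alpha$-balanced random variable $\xi$ with values in $\mathbb{F}_p$. Then $$\mathbf{P}(\operatorname{rank}(M)=n-d)=\frac{1}{p^{d^2}}\,\frac{\prod_{i=d+1}^{\infty}(1-p^{-i})}{\prod_{i=1}^{d}(1-p^{-i})}+O\big(e^{-n^{c'}}\big),$$ where the rank is taken over $\mathbb{F}_p$.
   Context: A random variable $\xi$ taking values in $\mathbb{F}_p$ is called $\alpha$-balanced if $\max_{a\in\mathbb{F}_p}\mathbf{P}(\xi=a)\le 1-\alpha$. *)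

(* Defs.v *)
From HB Require Import structures.
From mathcomp Require Import all_boot all_order all_algebra.
From mathcomp Require Import all_classical all_reals all_analysis.
Set Implicit Arguments.
Unset Strict Implicit.
Unset Printing Implicit Defensive.
Import Order.TTheory GRing.Theory Num.Theory.
Import numFieldNormedType.Exports.
Local Open Scope classical_set_scope.
Local Open Scope ring_scope.

(* 'F_p is convertible to some 'I_n.+1 and so inherits the discrete
   sigma-algebra. *)
HB.instance Definition _ (n : nat) := isPointed.Build 'I_n.+1 ord0.
HB.instance Definition _ (n : nat) := @isMeasurable.Build
  default_measure_display 'I_n.+1 discrete_measurable
  discrete_measurable0 discrete_measurableC
  discrete_measurableU.

Section random_variables.
Context {R : realType}.

Definition balanced {disp} {T : measurableType disp} {P : probability T R}
    {p : nat} (alpha : R) (xi : {RV P >-> 'F_p}) : Prop :=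
  (\big[maxe/-oo]_(a : 'F_p) P [set t | xi t = a] <= (1 - alpha)%:E)%E.

Definition identically_distributed {disp disp' dispV}
    {T : measurableType disp} {T' : measurableType disp'}
    {V : measurableType dispV} {P : probability T R} {P' : probability T' R}
    (X : {RV P >-> V}) (Y : {RV P' >-> V}) : Prop :=
  forall B : set V, measurable B -> distribution P X B = distribution P' Y B.

Definition mutually_independent {disp dispV} {T : measurableType disp}
    {V : measurableType dispV} {P : probability T R} {I : finType}
    (X : I -> {RV P >-> V}) : Prop :=
  forall (J : {set I}) (B : I -> set V), (forall i, measurable (B i)) ->
    P (\bigcap_(i in [set` J]) X i @^-1` B i)
    = (\prod_(i in J) P (X i @^-1` B i))%E.

Definition iid_copies {disp disp' dispV}
    {T : measurableType disp} {T' : measurableType disp'}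
    {V : measurableType dispV} {P : probability T R} {P' : probability T' R}
    {I : finType} (X : I -> {RV P >-> V}) (xi : {RV P' >-> V}) : Prop :=
  mutually_independent X /\ (forall i, identically_distributed (X i) xi).

(* The product over i >= m is the limit of its partial products, which converge
   when p > 1. *)
Definition inf_qprod (p m : nat) : R :=
  limn (fun N => \prod_(m <= i < N) (1 - p%:R ^- i) : R).

Definition limit_corank_prob (p d : nat) : R :=
  (p%:R ^+ (d ^ 2)%N)^-1
    * (inf_qprod p d.+1 / \prod_(1 <= i < d.+1) (1 - p%:R ^- i)).

End random_variables.

(* Main.v *)
(** Expose the rows one by one. The codimension of their span is then almost a
    Markov chain: if [U] has codimension [m], a new row falls into [U] with
    probability [p^-m], up to the largest Fourier coefficient
    [prod_j |E chi (F_j xi)|] over nonzero [F] orthogonal to [U]. The last [s]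
    steps of the exact chain have the law of the corank of a uniform [s x s]
    matrix, which is exponentially close to the limit. So it is enough that the
    first [n - s] rows, for [s] of order [n^(2c)], are independent and that no
    [F] in their orthogonal is structured, i.e. has a multiple with a large
    coefficient.

    By a union bound this follows if the sum of [P (v . F = 0) ^ (n - s)] over
    the structured [F] is small. Write [psi t = 1 - |E chi (t xi)|^2], which
    satisfies [psi (t + u) <= 2 (psi t + psi u)]. For structured [F] the sublevel
    sets of [t |-> sum_(j in S) psi (t F_j)] grow by any prescribed factor for
    every subset [S] of the support of [F] of size at least [s], whence
    [P (v . F = 0) <= const / 2^i * P (z . F = 0)] for a sparse symmetrized
    vector [z] on [S]. A typical [z] has many nonzero entries, and each relation
    [z . F = 0] determines one entry of [F] from the others; removing the entries
    one at a time, the sum over [F] with support [D] is at most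
    [p^s eps^(|D| - s)] with [eps] as small as we like. As also
    [P (v . F = 0) <= 1 - alpha / 2], summing over [D] gives
    [(p / eps)^s (1 - alpha / 2 + eps)^n]. *)

Require Import Defs.
From HB Require Import structures.
From mathcomp Require Import all_boot all_order all_algebra mxabelem.
From mathcomp Require Import all_classical all_reals all_analysis.
From mathcomp Require Import complex.
From mathcomp Require Import ring lra zify.
Import Order.TTheory GRing.Theory Num.Theory.
Import numFieldNormedType.Exports.
Local Open Scope classical_set_scope.
Local Open Scope ring_scope.

Set Implicit Arguments.
Unset Strict Implicit.
Unset Printing Implicit Defensive.

Import ComplexField.
Local Notation "R [i]" := (complex R).

(** * Characters of F_p *)

Lemma exists_character (R : realType) (p : nat) : prime p ->
  exists chi : 'F_p -> R[i],
    [/\ forall x y, chi (x + y) = chi x * chi y,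
        forall x, Normc.normc (chi x) = 1 &
        forall y, \sum_x chi (x * y) = if y == 0 then p%:R else 0].
Proof.
move=> p_pr; have p_gt1 := prime_gt1 p_pr.
(* [R[i]] is algebraically closed, so the p-th cyclotomic polynomial has a root; this root is a p-th
   root of unity, and it is not 1 because p is nonzero in characteristic 0. *)
have [w rw] : exists w : R[i], root (\sum_(i < p) 'X^i) w.
  apply/closed_rootP.
  have -> : \sum_(i < p) 'X^i = \poly_(i < p) 1 :> {poly R[i]}.
    by rewrite poly_def; apply: eq_bigr => i _; rewrite scale1r.
  by rewrite size_poly_eq ?oner_eq0 //; case: (p) p_gt1 => [|[|]].
have s0 : \sum_(i < p) w ^+ i = 0.
  move/rootP: rw; rewrite horner_sum.
  by under eq_bigr do rewrite hornerXn.
have wp : w ^+ p = 1 by apply/eqP; rewrite -subr_eq0 subrX1 s0 mulr0.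
have w1 : w != 1.
  apply/eqP => w1; move: s0; rewrite w1.
  under eq_bigr do rewrite expr1n.
  rewrite sumr_const card_ord => /eqP.
  by rewrite pnatr_eq0 -leqn0 leqNgt prime_gt0.
(* Addition in ['F_p] reduces modulo [(Zp_trunc (pdiv p)).+2], which equals p for prime p. *)
have wmod k : w ^+ (k %% (Zp_trunc (pdiv p)).+2) = w ^+ k.
  rewrite Fp_cast //.
  by rewrite [in RHS](divn_eq k p) exprD mulnC exprM wp expr1n mul1r.
pose chi (x : 'F_p) := w ^+ (x : nat).
have chiD x y : chi (x + y) = chi x * chi y.
  by rewrite /chi /= -exprD wmod.
have chi0 : chi 0 = 1 by [].
have chi1 : chi 1 = w by rewrite /chi /= wmod expr1.
have chiMn x k : chi (x *+ k) = chi x ^+ k.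
  by elim: k => [|k IH]; rewrite ?mulr0n ?expr0 // mulrS exprS chiD IH.
have nw : Normc.normc w = 1.
  have normX k : Normc.normc (w ^+ k) = Normc.normc w ^+ k.
    elim: k => [|k IH]; first by rewrite !expr0 Normc.normc1.
    by rewrite !exprS Normc.normcM IH.
  apply/eqP; rewrite -(@pexpr_eq1 _ _ p) ?prime_gt0 //; last by case: (w) => a b; exact: sqrtr_ge0.
  by rewrite -normX wp Normc.normc1.
exists chi; split => //.
  move=> x; rewrite /chi; elim: (x : nat) => [|k IH]; first by rewrite expr0 Normc.normc1.
  by rewrite exprS Normc.normcM nw IH mulr1.
move=> y; case: eqP => [->|/eqP y0].
  under eq_bigr do rewrite mulr0 chi0.
  by rewrite sumr_const card_Fp.
have cy : chi y != 1.
  apply: contra w1 => /eqP cy.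
  have -> : w = chi (y *+ (y^-1 : 'F_p)).
    by rewrite -mulr_natr natr_Zp mulfV.
  by rewrite chiMn cy expr1n.
(* Shifting [x] by 1 multiplies the sum by [chi y], which is not 1. *)
set S := \sum_x _.
have : S * chi y = S.
  rewrite /S mulr_suml [RHS](reindex_inj (addIr 1)) /=.
  by apply: eq_bigr => x _; rewrite mulrDl mul1r chiD.
move/eqP; rewrite -subr_eq0 -{2}(mulr1 S) -mulrBr mulf_eq0 subr_eq0 (negPf cy) orbF.
by move/eqP.
Qed.

(** * Distributivity for sums over vectors and matrices *)

Section Vectors.
Variables (A : finType) (S : comPzRingType).

Lemma sum_rV_prod n (G : 'I_n -> A -> S) :
  \sum_(v : 'rV[A]_n) \prod_j G j (v 0 j) = \prod_j \sum_a G j a.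
Proof.
rewrite bigA_distr_bigA (reindex (fun f : {ffun 'I_n -> A} => \row_j f j)) /=.
  by apply: eq_bigr => f _; apply: eq_bigr => j _; rewrite mxE.
exists (fun v : 'rV[A]_n => [ffun j => v 0 j]) => [f _|v _].
  by apply/ffunP => j; rewrite ffunE mxE.
by apply/rowP => j; rewrite mxE ffunE.
Qed.

Lemma sum_mx_prod m n (G : 'I_m -> 'rV[A]_n -> S) :
  \sum_(M : 'M[A]_(m, n)) \prod_i G i (row i M) = \prod_i \sum_v G i v.
Proof.
rewrite bigA_distr_bigA.
rewrite (reindex (fun f : {ffun 'I_m -> 'rV[A]_n} => \matrix_(i, j) f i 0 j)) /=.
  apply: eq_bigr => f _; apply: eq_bigr => j _; congr (G _ _).
  by apply/rowP => k; rewrite !mxE.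
exists (fun M : 'M[A]_(m, n) => [ffun i => row i M]) => [f _|M _].
  by apply/ffunP => i; rewrite ffunE; apply/rowP => j; rewrite !mxE.
by apply/matrixP => i j; rewrite !mxE ffunE mxE.
Qed.

End Vectors.

Definition dotv (K : pzRingType) n (u v : 'rV[K]_n) : K := \sum_j u 0 j * v 0 j.

(** * Fourier transforms and the probability of orthogonality *)

Section Fourier.
Variables (R : realType) (p : nat) (chi : 'F_p -> R[i]).
Hypothesis p_pr : prime p.
Hypothesis chiD : forall x y, chi (x + y) = chi x * chi y.
Hypothesis chi_norm : forall x, Normc.normc (chi x) = 1.
Hypothesis chi_sum : forall y, \sum_x chi (x * y) = if y == 0 then p%:R else 0.

Local Notation normc := Normc.normc.

Lemma normc_real (x : R) : normc x%:C%C = `|x|.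
Proof. by rewrite /normc /= expr0n addr0 sqrtr_sqr. Qed.

Lemma normc_ge0 (x : R[i]) : 0 <= normc x.
Proof. by case: x => a b; exact: sqrtr_ge0. Qed.

Lemma normc_sqr (z : R[i]) : normc z ^+ 2 = complex.Re z ^+ 2 + complex.Im z ^+ 2.
Proof. by case: z => a b; rewrite /normc /= sqr_sqrtr // addr_ge0 ?sqr_ge0. Qed.

Lemma normc_prod (I : finType) (G : I -> R[i]) :
  normc (\prod_j G j) = \prod_j normc (G j).
Proof. exact: (big_morph _ (@Normc.normcM R) (@Normc.normc1 R)). Qed.

Lemma normc_sum (I : finType) (D : pred I) (G : I -> R[i]) :
  normc (\sum_(j | D j) G j) <= \sum_(j | D j) normc (G j).
Proof.
elim/big_ind2: _ => //; first by rewrite Normc.normc0.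
by move=> x1 x2 y1 y2 h1 h2; apply: le_trans (lerD h1 h2); exact: le_normcD.
Qed.

Definition fourier (mu : 'F_p -> R) (x : 'F_p) : R[i] :=
  \sum_a (mu a)%:C%C * chi (x * a).

Lemma chi0 : chi 0 = 1.
Proof.
have := chiD 0 0; rewrite addr0 => /eqP.
rewrite -{1}(mulr1 (chi 0)) -subr_eq0 -mulrBr mulf_eq0 => /orP[/eqP c0|].
  by have := chi_norm 0; rewrite c0 Normc.normc0 => /esym/eqP; rewrite oner_eq0.
by rewrite subr_eq0 => /eqP.
Qed.

Lemma chi_prod (I : finType) (G : I -> 'F_p) :
  chi (\sum_j G j) = \prod_j chi (G j).
Proof. exact: (big_morph _ chiD chi0). Qed.

Lemma p_neq0 : p%:R != 0 :> R. Proof. by rewrite pnatr_eq0 -lt0n prime_gt0. Qed.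

Lemma p_gt0 : 0 < p%:R :> R. Proof. by rewrite ltr0n prime_gt0. Qed.

Lemma fourier_prod n (nu : 'I_n -> 'F_p -> R) (w : 'rV['F_p]_n) :
  \sum_(v : 'rV['F_p]_n) (\prod_j nu j (v 0 j))%:C%C * chi (dotv v w)
  = \prod_j fourier (nu j) (w 0 j).
Proof.
rewrite /fourier -sum_rV_prod; apply: eq_bigr => v _.
rewrite rmorph_prod chi_prod -big_split /=; apply: eq_bigr => j _.
by rewrite [w 0 j * _]mulrC.
Qed.

(** The mean of [chi (t * dotv v w)] over [t] is the indicator of [dotv v w = 0], and for each [t]
    the sum over [v] factors over the coordinates. *)
Lemma prob_dot0 n (nu : 'I_n -> 'F_p -> R) (w : 'rV['F_p]_n) :
  (\sum_(v : 'rV['F_p]_n) (\prod_j nu j (v 0 j)) * (dotv v w == 0)%:R)%:C%C * p%:R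
  = \sum_t \prod_j fourier (nu j) (t * w 0 j).
Proof.
under [RHS]eq_bigr => t _.
  have -> : \prod_j fourier (nu j) (t * w 0 j)
     = \prod_j fourier (nu j) ((t *: w) 0 j) by apply: eq_bigr => j _; rewrite mxE.
  rewrite -fourier_prod.
  over.
rewrite exchange_big /= rmorph_sum mulr_suml; apply: eq_bigr => v _.
have dotvZ t : dotv v (t *: w) = t * dotv v w.
  by rewrite /dotv mulr_sumr; apply: eq_bigr => j _; rewrite mxE mulrCA.
under [RHS]eq_bigr do rewrite dotvZ.
rewrite -mulr_sumr chi_sum rmorphM /= -mulrA; congr (_ * _).
by case: eqP => _; rewrite ?mul1r ?mul0r.
Qed.

Lemma prob_dot0_le n (nu : 'I_n -> 'F_p -> R) (w : 'rV['F_p]_n) :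
  \sum_(v : 'rV['F_p]_n) (\prod_j nu j (v 0 j)) * (dotv v w == 0)%:R
  <= p%:R^-1 * \sum_t \prod_j normc (fourier (nu j) (t * w 0 j)).
Proof.
rewrite mulrC ler_pdivlMr ?p_gt0 //.
set s := \sum_v _.
have h := prob_dot0 nu w; rewrite -/s in h.
apply: (@le_trans _ _ (normc (s%:C%C * p%:R))).
  rewrite Normc.normcM normc_real -(rmorph_nat (real_complex R)) normc_real normr_nat.
  by rewrite ler_wpM2r ?ler0n // ler_norm.
rewrite h; apply: (le_trans (normc_sum _ _)).
by apply: ler_sum => t _; rewrite normc_prod.
Qed.

Lemma prob_dot0_real n (nu : 'I_n -> 'F_p -> R) (h : 'I_n -> 'F_p -> R) (w : 'rV['F_p]_n) :
  (forall j x, fourier (nu j) x = (h j x)%:C%C) ->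
  \sum_(v : 'rV['F_p]_n) (\prod_j nu j (v 0 j)) * (dotv v w == 0)%:R
  = p%:R^-1 * \sum_t \prod_j h j (t * w 0 j).
Proof.
move=> hh; apply: (mulIf p_neq0); rewrite [p%:R^-1 * _]mulrC mulfVK ?p_neq0 //.
apply: (@complexI R); rewrite rmorphM rmorph_nat prob_dot0 rmorph_sum.
by apply: eq_bigr => t _; rewrite rmorph_prod; apply: eq_bigr => j _; rewrite hh.
Qed.

End Fourier.

(** * The function psi and symmetrization *)

Section Psi.
Variables (R : realType) (p : nat) (chi : 'F_p -> R[i]).
Hypothesis p_pr : prime p.
Hypothesis chiD : forall x y, chi (x + y) = chi x * chi y.
Hypothesis chi_norm : forall x, Normc.normc (chi x) = 1.
Hypothesis chi_sum : forall y, \sum_x chi (x * y) = if y == 0 then p%:R else 0.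
Local Notation normc := Normc.normc.
Local Notation chi0 := (chi0 chiD chi_norm).

Local Notation c y := (complex.Re (chi y)).
Local Notation s y := (complex.Im (chi y)).

Lemma ReD (x y : R[i]) : complex.Re (x + y) = complex.Re x + complex.Re y.
Proof. by case: x y => [a b] []. Qed.

Lemma ImD (x y : R[i]) : complex.Im (x + y) = complex.Im x + complex.Im y.
Proof. by case: x y => [a b] []. Qed.

Lemma Re_sum (I : finType) (G : I -> R[i]) :
  complex.Re (\sum_j G j) = \sum_j complex.Re (G j).
Proof. exact: (big_morph _ ReD). Qed.

Lemma Im_sum (I : finType) (G : I -> R[i]) :
  complex.Im (\sum_j G j) = \sum_j complex.Im (G j).
Proof. exact: (big_morph _ ImD). Qed.

Lemma Re_scale (x : R) (z : R[i]) : complex.Re (x%:C%C * z) = x * complex.Re z.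
Proof. by case: z => a b /=; rewrite mul0r subr0. Qed.

Lemma Im_scale (x : R) (z : R[i]) : complex.Im (x%:C%C * z) = x * complex.Im z.
Proof. by case: z => a b /=; rewrite mul0r addr0. Qed.

Lemma Re_Im_chi y : c y ^+ 2 + s y ^+ 2 = 1.
Proof. by rewrite -normc_sqr chi_norm expr1n. Qed.

Lemma Re_chiD y z : c (y + z) = c y * c z - s y * s z.
Proof. by rewrite chiD; case: (chi y) (chi z) => [? ?] []. Qed.

(** [chi (- y)] is the inverse of a number of modulus 1, hence its conjugate. *)
Lemma Re_chiN y : c (- y) = c y.
Proof.
have h : chi y * chi (- y) = 1 by rewrite -chiD subrr chi0.
have := Re_Im_chi y; have := Re_Im_chi (- y); move: h.
case: (chi y) (chi (- y)) => [a b] [a' b'] /= [h1 h2] e1 e2.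
have : a' = a' * (a ^+ 2 + b ^+ 2) by rewrite e2 mulr1.
move=> ->; transitivity (a * (a * a' - b * b') + b * (a * b' + b * a')); first by ring.
by rewrite h1 h2; ring.
Qed.

Lemma Im_chiN y : s (- y) = - s y.
Proof.
have h : chi y * chi (- y) = 1 by rewrite -chiD subrr chi0.
have := Re_Im_chi y; have := Re_Im_chi (- y); move: h.
case: (chi y) (chi (- y)) => [a b] [a' b'] /= [h1 h2] e1 e2.
have : b' = b' * (a ^+ 2 + b ^+ 2) by rewrite e2 mulr1.
move=> ->; transitivity (a * (a * b' + b * a') - b * (a * a' - b * b')); first by ring.
by rewrite h1 h2; ring.
Qed.

Lemma Re_chiB y z : c (y - z) = c y * c z + s y * s z.
Proof. by rewrite Re_chiD Re_chiN Im_chiN; ring. Qed.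

Lemma Re_chi_le1 y : c y <= 1.
Proof. by have := Re_Im_chi y; have := sqr_ge0 (s y); nra. Qed.

(* [2 - 2 * c y] is |1 - chi y|^2, and the difference of the two sides is
   |1 - 2 chi y + chi y chi z|^2. *)
Lemma Re_chiD_le y z : 2 - 2 * c (y + z) <= 2 * (2 - 2 * c y) + 2 * (2 - 2 * c z).
Proof.
rewrite Re_chiD -subr_ge0.
have e1 := Re_Im_chi y; have e2 := Re_Im_chi z.
set a := c y in e1 *; set b := s y in e1 *; set a' := c z in e2 *; set b' := s z in e2 *.
have : 0 <= (1 - 2 * a + (a * a' - b * b')) ^+ 2 + (- 2 * b + (a * b' + b * a')) ^+ 2.
  by rewrite addr_ge0 ?sqr_ge0.
suff -> : (1 - 2 * a + (a * a' - b * b')) ^+ 2 + (- 2 * b + (a * b' + b * a')) ^+ 2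
  = 6 - 4 * a - 4 * a' + 2 * (a * a' - b * b') by lra.
transitivity (1 + (a ^+ 2 + b ^+ 2) * (4 - 4 * a' + (a' ^+ 2 + b' ^+ 2)) - 4 * a + 2 * (a * a' - b * b')).
  by ring.
by rewrite e1 e2; ring.
Qed.

Lemma Re_chi_sum y : \sum_t c (t * y) = if y == 0 then p%:R else 0.
Proof.
rewrite -Re_sum chi_sum; case: eqP => // _.
by rewrite -(rmorph_nat (real_complex R)).
Qed.

Variable mu : 'F_p -> R.
Hypothesis mu_ge0 : forall a, 0 <= mu a.
Hypothesis mu_sum1 : \sum_a mu a = 1.

(** Half the mean of |1 - chi (x (xi - xi'))|^2: in this form nonnegativity and [psiD] hold term by
    term, and [fourier_sqr] identifies it with 1 - |E chi (x xi)|^2. *)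
Definition psi (x : 'F_p) : R :=
  2^-1 * \sum_a \sum_b mu a * mu b * (2 - 2 * c (x * (a - b))).

Lemma psi_ge0 x : 0 <= psi x.
Proof.
rewrite mulr_ge0 ?invr_ge0 ?ler0n //; apply: sumr_ge0 => a _; apply: sumr_ge0 => b _.
by rewrite !mulr_ge0 //; have := Re_chi_le1 (x * (a - b)); lra.
Qed.

Lemma psi0 : psi 0 = 0.
Proof.
rewrite /psi big1 ?mulr0 // => a _; rewrite big1 // => b _.
by rewrite mul0r chi0 /= mulr1 subrr mulr0.
Qed.

Lemma psiN x : psi (- x) = psi x.
Proof.
congr (_ * _); apply: eq_bigr => a _; apply: eq_bigr => b _.
by rewrite mulNr Re_chiN.
Qed.

Lemma psiD x y : psi (x + y) <= 2 * (psi x + psi y).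
Proof.
suff : \sum_a \sum_b mu a * mu b * (2 - 2 * c ((x + y) * (a - b))) <=
    2 * \sum_a \sum_b mu a * mu b * (2 - 2 * c (x * (a - b))) +
    2 * \sum_a \sum_b mu a * mu b * (2 - 2 * c (y * (a - b))).
  by rewrite /psi; lra.
rewrite !mulr_sumr -big_split /=; apply: ler_sum => a _.
rewrite !mulr_sumr -big_split /=; apply: ler_sum => b _.
rewrite [(x + y) * _]mulrDl.
have := Re_chiD_le (x * (a - b)) (y * (a - b)).
have : 0 <= mu a * mu b by rewrite mulr_ge0.
by nra.
Qed.

Lemma fourier_sqr x : normc (fourier chi mu x) ^+ 2 = 1 - psi x.
Proof.
have -> : 1 - psi x = \sum_a \sum_b mu a * mu b * c (x * (a - b)).
  have e : \sum_a \sum_b mu a * mu b = 1.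
    by under eq_bigr do rewrite -mulr_sumr mu_sum1 mulr1; rewrite mu_sum1.
  transitivity (\sum_a \sum_b mu a * mu b - psi x); first by rewrite e.
  rewrite /psi.
  rewrite mulr_sumr -sumrB; apply: eq_bigr => a _.
  rewrite mulr_sumr -sumrB; apply: eq_bigr => b _.
  by field.
rewrite normc_sqr /fourier Re_sum Im_sum !expr2 !mulr_suml -big_split /=.
apply: eq_bigr => a _; rewrite !mulr_sumr -big_split /=; apply: eq_bigr => b _.
by rewrite !Re_scale !Im_scale mulrBr Re_chiB; ring.
Qed.

Lemma psi_le1 x : psi x <= 1.
Proof. by rewrite -subr_ge0 -fourier_sqr sqr_ge0. Qed.

Lemma fourier_le x : normc (fourier chi mu x) <= expR (- (psi x / 2)).
Proof.
rewrite -(@ler_pXn2r _ 2) // ?nnegrE ?expR_ge0 ?normc_ge0 // fourier_sqr -expRM_natl.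
have -> : 2%:R * - (psi x / 2) = - psi x by field.
exact: expR_ge1Dx.
Qed.

Lemma fourier_le1 x : normc (fourier chi mu x) <= 1.
Proof.
apply: (le_trans (fourier_le x)); rewrite -[leRHS]expR0 ler_expR oppr_le0.
by rewrite mulr_ge0 ?psi_ge0 ?invr_ge0 ?ler0n.
Qed.

(** The cosines sum to zero over [t] unless [a = b], so the mean of [psi] over the multiples of [x]
    is the probability that two independent copies differ. *)
Lemma psi_sum x : x != 0 -> \sum_t psi (t * x) = p%:R * (1 - \sum_a mu a ^+ 2).
Proof.
move=> x0; rewrite /psi -mulr_sumr exchange_big /=.
have -> : p%:R * (1 - \sum_a mu a ^+ 2) =
    2^-1 * \sum_a \sum_b mu a * mu b * (2 * p%:R - 2 * (if a == b then p%:R else 0)).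
  have -> : \sum_a \sum_b mu a * mu b * (2 * p%:R - 2 * (if a == b then p%:R else 0)) =
    \sum_a (2 * p%:R * mu a - 2 * p%:R * mu a ^+ 2).
    apply: eq_bigr => a _.
    transitivity (2 * p%:R * mu a * \sum_b mu b - 2 * p%:R * mu a ^+ 2); last first.
      by rewrite mu_sum1 mulr1.
    rewrite mulr_sumr (bigD1 a) //= [in RHS](bigD1 a) //= eqxx.
    rewrite [in RHS]addrAC; congr (_ + _); first by ring.
    by apply: eq_bigr => b ba; rewrite eq_sym (negPf ba); ring.
  by rewrite sumrB -!mulr_sumr mu_sum1; field.
congr (_ * _); apply: eq_bigr => a _; rewrite exchange_big /=; apply: eq_bigr => b _.
rewrite -mulr_sumr; congr (_ * _); rewrite sumrB -mulr_sumr; congr (_ - _ * _).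
  by rewrite sumr_const card_Fp // mulr_natr.
under eq_bigr do rewrite -mulrA.
by rewrite Re_chi_sum mulf_eq0 (negPf x0) subr_eq0.
Qed.

(* The law of [xi - xi'] for independent [xi], [xi'] of law [mu]. *)
Definition sym_law (b : 'F_p) : R := \sum_a mu a * mu (a - b).

Lemma sym_ge0 b : 0 <= sym_law b.
Proof. by apply: sumr_ge0 => a _; rewrite mulr_ge0. Qed.

Lemma sym_sum1 : \sum_b sym_law b = 1.
Proof.
rewrite exchange_big /= -mu_sum1; apply: eq_bigr => a _.
rewrite -mulr_sumr (reindex_inj (subrI a)) /=.
by under eq_bigr do rewrite subKr; rewrite mu_sum1 mulr1.
Qed.

Lemma sym0 : sym_law 0 = \sum_a mu a ^+ 2.
Proof. by apply: eq_bigr => a _; rewrite subr0 expr2. Qed.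

Lemma fourier_sym x : fourier chi sym_law x = (1 - psi x)%:C%C.
Proof.
have -> : fourier chi sym_law x = \sum_a \sum_b (mu a * mu b)%:C%C * chi (x * (a - b)).
  rewrite /fourier /sym_law.
  under eq_bigr do rewrite rmorph_sum mulr_suml.
  rewrite exchange_big /=; apply: eq_bigr => a _.
  by rewrite (reindex_inj (subrI a)) /=; apply: eq_bigr => b _; rewrite subKr.
have e z : z = (complex.Re z)%:C%C :> R[i] <-> complex.Im z = 0.
  by case: z => u v /=; split => [[]|->].
set z := LHS.
(* Exchanging [a] and [b] conjugates the double sum. *)
have zI : complex.Im z = 0.
  have h : complex.Im z = - complex.Im z.
    rewrite {1}/z exchange_big /z !Im_sum -sumrN; apply: eq_bigr => a _.
    rewrite !Im_sum -sumrN; apply: eq_bigr => b _.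
    by rewrite !Im_scale -(opprB a b) mulrN Im_chiN mulrN [mu b * _]mulrC.
  by move: h; set y := complex.Im z => h; lra.
rewrite (e z).2 //; congr (_ %:C%C).
rewrite -fourier_sqr normc_sqr /fourier /z !Re_sum Im_sum !expr2 !mulr_suml -big_split /=.
apply: eq_bigr => a _; rewrite Re_sum !mulr_sumr -big_split /=; apply: eq_bigr => b _.
by rewrite !Re_scale !Im_scale mulrBr Re_chiB; ring.
Qed.

End Psi.

(** * Growth of sublevel sets *)

Section Growth.
Variables (R : realType) (p : nat) (Psi : 'F_p -> R).
Hypothesis p_pr : prime p.
Hypothesis PsiN : forall x, Psi (- x) = Psi x.
Hypothesis PsiD : forall x y, Psi (x + y) <= 2 * (Psi x + Psi y).

Local Notation T M := [set t : 'F_p | Psi t <= M]%SET.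

(* If A = T M and x is in A - A but x + t0 is not, then A and x + t0 + A are
   disjoint subsets of T (16 M). *)
Lemma sublevel_double (M : R) (t0 : 'F_p) : 0 <= M -> t0 != 0 -> Psi t0 <= M ->
  ~ (forall t, Psi t <= 16 * M) -> (2 * #|T M| <= #|T (16 * M)%R|)%N.
Proof.
move=> M0 t00 ht0 nall.
pose A2 (x : 'F_p) := exists a b : 'F_p, [/\ Psi a <= M, Psi b <= M & x = a - b].
have A2le x : A2 x -> Psi x <= 4 * M.
  by move=> [a [b [ha hb ->]]]; have := PsiD a (- b); rewrite PsiN; lra.
(* Otherwise A - A would contain every multiple of [t0], hence all of 'F_p, and [Psi] would be at
   most [4 * M] everywhere. *)
have [x [xA2 nxA2]] : exists x, A2 x /\ ~ A2 (x + t0).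
  apply: contrapT => /forallNP h; apply: nall => t.
  suff : A2 t by move/A2le; lra.
  have -> : t = t0 *+ (t / t0 : 'F_p) by rewrite -mulr_natr natr_Zp mulrC divfK.
  elim: (t / t0 : nat) => [|k IH]; first by exists t0, t0; rewrite mulr0n subrr.
  by rewrite mulrSr; apply: contrapT => nk; apply: (h (t0 *+ k)).
pose y := x + t0.
pose B := [set y + c | c in T M]%SET.
have cB : #|B| = #|T M| by apply: card_imset; exact: addrI.
have dis : (T M :&: B)%SET = finset.set0.
  apply/setP => c; rewrite !inE; apply/negP => /andP[hc /imsetP[c']].
  rewrite inE => hc' e; apply: nxA2; exists c, c'; split => //.
  by rewrite e addrK.
have -> : (2 * #|T M|)%N = #|(T M :|: B)%SET|.
  by rewrite cardsU dis cards0 subn0 cB mul2n addnn.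
apply: subset_leq_card; apply/fintype.subsetP => z; rewrite !inE => /orP[hz|/imsetP[c]].
  by apply: (le_trans hz); lra.
(* 2 (4 M + 2 (M + M)) = 16 M is where the factor 16 comes from. *)
rewrite inE => hc ->; rewrite /y -addrA.
by have := PsiD x (t0 + c); have := PsiD t0 c; have := A2le _ xA2; lra.
Qed.

(** The levels increase, so [t0] stays in all the sublevel sets, and a set that is not full at the
    last level is not full at an earlier one. *)
Lemma sublevel_growth (i : nat) (M : R) (t0 : 'F_p) : 0 <= M -> t0 != 0 -> Psi t0 <= M ->
  ~ (forall t, Psi t <= 16 ^+ i * M) -> (2 ^ i * #|T M| <= #|T (16 ^+ i * M)%R|)%N.
Proof.
move=> M0 t00 ht0; elim: i => [|i IH] nall; first by rewrite expr0 mul1r expn0 mul1n.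
have e16 : (1 : R) <= 16 ^+ i by apply: exprn_ege1; lra.
have M1 : M <= 16 ^+ i * M by nra.
have M2 : 0 <= 16 ^+ i * M by lra.
rewrite exprS -mulrA in nall *.
apply: leq_trans (sublevel_double M2 t00 (le_trans ht0 M1) nall).
rewrite expnS -mulnA leq_mul2l /=; apply: IH => h; apply: nall => t.
by apply: (le_trans (h t)); lra.
Qed.

End Growth.

(** * Counting the structured vectors *)

(** Weierstrass's product inequality. *)
Lemma prod_ge1B (R : realType) (I : Type) (r : seq I) (x : I -> R) :
  (forall j, 0 <= x j <= 1) -> 1 - \sum_(j <- r) x j <= \prod_(j <- r) (1 - x j).
Proof.
move=> hx; elim: r => [|j r IH]; first by rewrite !big_nil subr0.
rewrite !big_cons.
have h0 : 0 <= \sum_(j <- r) x j by apply: sumr_ge0 => k _; case/andP: (hx k).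
have h1 : 0 <= \prod_(j <- r) (1 - x j) <= 1.
  rewrite prodr_ge0 ?prodr_ile1 // => k _; have := hx k; lra.
have := hx j; move: IH h0 h1.
set S := \sum_(_ <- _) _; set P := \prod_(_ <- _) _; nra.
Qed.

Section Core.
Variables (R : realType) (p : nat) (chi : 'F_p -> R[i]).
Hypothesis p_pr : prime p.
Hypothesis chiD : forall x y, chi (x + y) = chi x * chi y.
Hypothesis chi_norm : forall x, Normc.normc (chi x) = 1.
Hypothesis chi_sum : forall y, \sum_x chi (x * y) = if y == 0 then p%:R else 0.
Variable mu : 'F_p -> R.
Hypothesis mu_ge0 : forall a, 0 <= mu a.
Hypothesis mu_sum1 : \sum_a mu a = 1.
Variable alpha : R.
Hypothesis alpha_gt0 : 0 < alpha.
Hypothesis mu_sqr : \sum_a mu a ^+ 2 <= 1 - alpha.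

Local Notation normc := Normc.normc.
Local Notation psi := (psi chi mu).
Local Notation p_gt0 := (p_gt0 R p_pr).
Local Notation p_neq0 := (p_neq0 R p_pr).

Lemma alpha_le1 : alpha <= 1.
Proof.
rewrite -subr_ge0; apply: le_trans mu_sqr.
by apply: sumr_ge0 => a _; apply: sqr_ge0.
Qed.

Section Dim.
Variable n : nat.
Implicit Types (F : 'rV['F_p]_n) (S D : {set 'I_n}) (t : 'F_p).

Definition Psi_on S F t : R := \sum_(j in S) psi (t * F 0 j).

(* The probability that a vector with iid entries of law [mu] is orthogonal
   to [F]. *)
Definition orth_prob F : R :=
  \sum_(v : 'rV['F_p]_n) (\prod_j mu (v 0 j)) * (dotv v F == 0)%:R.

Lemma orth_prob_ge0 F : 0 <= orth_prob F.
Proof. by apply: sumr_ge0 => v _; rewrite mulr_ge0 ?ler0n // prodr_ge0. Qed.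

Lemma orth_prob_fourier F :
  orth_prob F <= p%:R^-1 * \sum_t \prod_j normc (fourier chi mu (t * F 0 j)).
Proof. exact: (prob_dot0_le p_pr chiD chi_norm chi_sum (fun=> mu)). Qed.

Lemma fourier01 x : 0 <= normc (fourier chi mu x) <= 1.
Proof. by rewrite normc_ge0 fourier_le1. Qed.

(** One nonzero entry suffices: its Fourier factor is at most 1 - psi / 2, and the mean of [psi]
    over the multiples of this entry is at least [alpha]. *)
Lemma orth_prob_neq0 F : F != 0 -> orth_prob F <= 1 - alpha / 2.
Proof.
move=> F0; apply: (le_trans (orth_prob_fourier F)).
have [j Fj] : exists j, F 0 j != 0.
  by apply/existsP; apply: contraNT F0 => /existsPn h; apply/eqP/rowP => j; rewrite mxE; apply/eqP/negPn/h.
rewrite mulrC ler_pdivrMr ?p_gt0 //.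
have -> : (1 - alpha / 2) * p%:R = \sum_(t : 'F_p) (1 : R) - p%:R * alpha / 2.
  by rewrite sumr_const card_Fp //; field.
have := psi_sum p_pr chi_sum mu_sum1 Fj => e.
have : p%:R * alpha <= \sum_t psi (t * F 0 j).
  by rewrite e ler_pM2l ?p_gt0 // lerBrDr addrC -lerBrDr.
move=> {}e; apply: (@le_trans _ _ (\sum_t (1 - 2^-1 * psi (t * F 0 j)))); last first.
  by rewrite sumrB -mulr_sumr; lra.
apply: ler_sum => t _; rewrite (bigD1 j) //=.
apply: (@le_trans _ _ (normc (fourier chi mu (t * F 0 j)))).
  rewrite ler_piMr ?normc_ge0 //; apply: prodr_ile1 => k _; exact: fourier01.
rewrite -(@ler_pXn2r _ 2) // ?nnegrE ?normc_ge0 //.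
  by rewrite fourier_sqr //; nra.
by have := psi_le1 chiD chi_norm mu_sum1 (t * F 0 j); lra.
Qed.

Lemma Psi_onN S F t : Psi_on S F (- t) = Psi_on S F t.
Proof. by apply: eq_bigr => j _; rewrite mulNr psiN. Qed.

Lemma Psi_onD S F t u : Psi_on S F (t + u) <= 2 * (Psi_on S F t + Psi_on S F u).
Proof.
rewrite /Psi_on -big_split mulr_sumr /=; apply: ler_sum => j _.
by rewrite mulrDl; apply: psiD.
Qed.

Lemma Psi_on_ge0 S F t : 0 <= Psi_on S F t.
Proof. by apply: sumr_ge0 => j _; apply: psi_ge0. Qed.

Lemma Psi_on0 S F : Psi_on S F 0 = 0.
Proof. by rewrite /Psi_on big1 // => j _; rewrite mul0r psi0. Qed.

Lemma Psi_on_sub S D F t : S \subset D -> Psi_on S F t <= Psi_on D F t.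
Proof.
move=> SD; rewrite /Psi_on [leRHS](big_setID S) /= (finset.setIidPr SD).
by rewrite lerDl; apply: sumr_ge0 => j _; apply: psi_ge0.
Qed.

Lemma orth_prob_le_exp S F : orth_prob F <= p%:R^-1 * \sum_t expR (- (Psi_on S F t / 2)).
Proof.
apply: (le_trans (orth_prob_fourier F)); rewrite ler_wpM2l ?invr_ge0 ?ler0n //.
apply: ler_sum => t _.
have -> : expR (- (Psi_on S F t / 2)) = \prod_(j in S) expR (- (psi (t * F 0 j) / 2)).
  by rewrite -expR_sum; congr expR; rewrite sumrN mulr_suml.
rewrite [leRHS]big_mkcond /=; apply: ler_prod => j _; rewrite normc_ge0 /=.
by case: ifP => _; [apply: fourier_le|apply: fourier_le1].
Qed.


(** * Comparison with a sparse symmetrized vector *)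

Section Params.
Variables (i s : nat) (m : R).
Hypothesis m_ge1 : 1 <= m.
Hypothesis p_le : p%:R <= expR (m / 2).

Definition radius : R := 16 ^+ i * m.
(** Chosen so that [laziness * radius] is 1/2; see [lazy_orth_prob_ge]. *)
Definition laziness : R := (2 * radius)^-1.

(** [s_gt] keeps the sublevel set of level [radius] from being full, and [s_exp] makes the event of
    few nonzero entries negligible against 1 / p. *)
Hypothesis s_gt : radius < s%:R * alpha.
Hypothesis s_exp : expR (- (laziness * alpha * s%:R / 4)) <= (4 * p%:R)^-1.

Local Notation T S F M := [set t : 'F_p | Psi_on S F t <= M]%SET.

Lemma radius_ge1 : 1 <= radius.
Proof. by rewrite mulr_ege1 // exprn_ege1 //; lra. Qed.

Lemma laziness_gt0 : 0 < laziness.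
Proof. by rewrite /laziness invr_gt0; have := radius_ge1; lra. Qed.

Lemma laziness_le1 : laziness <= 1.
Proof. by rewrite /laziness invf_le1; have := radius_ge1; lra. Qed.

(** Outside the sublevel set each exponential is at most 1 / p, so together they add at most 1, and
    the set has at least the element 0. *)
Lemma orth_prob_le_T S F : orth_prob F <= p%:R^-1 * (2 * #|T S F m|%:R).
Proof.
apply: (le_trans (orth_prob_le_exp S F)); rewrite ler_wpM2l ?invr_ge0 ?ler0n //.
have T_ge1 : 1 <= #|T S F m|%:R :> R.
  rewrite -[1]/(1%:R) ler_nat; apply/card_gt0P; exists 0.
  by rewrite inE Psi_on0 (le_trans ler01).
apply: (@le_trans _ _ (\sum_(t : 'F_p) ((t \in T S F m)%:R + p%:R^-1))).
  apply: ler_sum => t _; rewrite inE; case: (leP (Psi_on S F t) m) => h /=.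
    rewrite (_ : true%:R = 1 :> R) // -[leLHS]addr0 lerD ?invr_ge0 ?ler0n //.
    by rewrite -[leRHS]expR0 ler_expR oppr_le0 divr_ge0 ?Psi_on_ge0 ?ler0n.
  rewrite (_ : false%:R = 0 :> R) // add0r expRN lef_pV2 ?posrE ?expR_gt0 ?p_gt0 //.
  by apply: (le_trans p_le); rewrite ler_expR; lra.
rewrite big_split /= sumr_const card_Fp // -[_ *+ p]mulr_natr mulVf ?p_neq0 //.
have -> : \sum_(t : 'F_p) (t \in T S F m)%:R = #|T S F m|%:R :> R.
  by rewrite -natr_sum -sum1_card [in RHS]big_mkcond.
by lra.
Qed.

(* The entries in [S] are kept with probability [laziness] and are then copies
   of [xi - xi']; all other entries are 0. Since the transform of [sym_law] is
   nonnegative, so are all the terms of [lazy_orth_prob_fourier]. *)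
Definition lazy_law S (j : 'I_n) (z : 'F_p) : R :=
  if j \in S then (1 - laziness) * (z == 0)%:R + laziness * sym_law mu z else (z == 0)%:R.

Lemma lazy_law_ge0 S j z : 0 <= lazy_law S j z.
Proof.
rewrite /lazy_law; case: ifP => _; rewrite ?ler0n // addr_ge0 // mulr_ge0 ?ler0n ?sym_ge0 //.
  by have := laziness_le1; lra.
exact: ltW laziness_gt0.
Qed.

Lemma sum_eq0_indic : \sum_(z : 'F_p) (z == 0)%:R = 1 :> R.
Proof. by rewrite (bigD1 0) //= big1 ?addr0 // => z /negPf ->. Qed.

Lemma lazy_law_sum1 S j : \sum_z lazy_law S j z = 1.
Proof.
rewrite /lazy_law; case: (j \in S); last first.
  exact: sum_eq0_indic.
transitivity ((1 - laziness) * \sum_(z : 'F_p) (z == 0)%:R + laziness * \sum_z sym_law mu z).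
  by rewrite !mulr_sumr -big_split.
by rewrite sym_sum1 // sum_eq0_indic; ring.
Qed.

Lemma lazy_law_neq0 S j : \sum_z lazy_law S j z * (z != 0)%:R =
  if j \in S then laziness * (1 - \sum_a mu a ^+ 2) else 0.
Proof.
have -> : \sum_z lazy_law S j z * (z != 0)%:R = 1 - lazy_law S j 0.
  transitivity (\sum_z lazy_law S j z - lazy_law S j 0); last by rewrite lazy_law_sum1.
  rewrite (bigD1 0) //= [in RHS](bigD1 0) //= mulr0 add0r addrAC subrr add0r.
  by apply: eq_bigr => z z0; rewrite z0 mulr1.
rewrite /lazy_law eqxx; case: ifP => _; rewrite ?subrr //.
by rewrite sym0 -[true%:R]/(1 : R); ring.
Qed.

Definition lazy_orth_prob S F : R :=
  \sum_(z : 'rV['F_p]_n) (\prod_j lazy_law S j (z 0 j)) * (dotv z F == 0)%:R.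

Lemma lazy_orth_prob_fourier S F :
  lazy_orth_prob S F = p%:R^-1 * \sum_t \prod_(j in S) (1 - laziness * psi (t * F 0 j)).
Proof.
rewrite /lazy_orth_prob (prob_dot0_real p_pr chiD chi_norm chi_sum
  (h := fun j x => if j \in S then 1 - laziness * psi x else 1)).
  by congr (_ * _); apply: eq_bigr => t _; rewrite [RHS]big_mkcond.
move=> j x; rewrite /fourier /lazy_law; case: (j \in S).
  have -> : 1 - laziness * psi x = (1 - laziness) + laziness * (1 - psi x) by ring.
  rewrite rmorphD rmorphM /= -(fourier_sym chiD chi_norm) // /fourier mulr_sumr.
  have -> : (1 - laziness)%:C%C = \sum_a ((1 - laziness) * (a == 0)%:R)%:C%C * chi (x * a) :> R[i].
    rewrite (bigD1 0) //= -[true%:R]/(1 : R) mulr1 mulr0 (chi0 chiD chi_norm) mulr1 big1 ?addr0 //.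
    by move=> a /negPf ->; rewrite mulr0 mul0r.
  rewrite -big_split /=; apply: eq_bigr => a _.
  by rewrite rmorphD mulrDl [in RHS]mulrA -rmorphM.
rewrite (bigD1 0) //= mulr0 (chi0 chiD chi_norm) mulr1 big1 ?addr0 //.
by move=> a /negPf ->; rewrite mul0r.
Qed.

(** On the sublevel set the product is at least 1 - laziness * radius = 1/2; the other terms are
    nonnegative and dropped. *)
Lemma lazy_orth_prob_ge S F : p%:R^-1 * (2^-1 * #|T S F radius|%:R) <= lazy_orth_prob S F.
Proof.
rewrite lazy_orth_prob_fourier ler_wpM2l ?invr_ge0 ?ler0n //.
have q01 x : 0 <= laziness * psi x <= 1.
  have := laziness_gt0; have := laziness_le1; have := psi_ge0 chi_norm mu_ge0 x.
  by have := psi_le1 chiD chi_norm mu_sum1 x; nra.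
have -> : 2^-1 * #|T S F radius|%:R = \sum_(t in T S F radius) 2^-1 :> R.
  by rewrite sumr_const mulr_natr.
rewrite [leRHS](bigID (mem (T S F radius))) /= -[leLHS]addr0 lerD //; last first.
  by apply: sumr_ge0 => t _; apply: prodr_ge0 => j _; have := q01 (t * F 0 j); lra.
apply: ler_sum => t; rewrite inE => ht.
have h := @prod_ge1B R 'I_n [seq j <- index_enum 'I_n | j \in S] _ (fun j => q01 (t * F 0 j)).
rewrite !big_filter in h; apply: le_trans h.
rewrite -mulr_sumr -/(Psi_on S F t).
have : laziness * Psi_on S F t <= laziness * radius by rewrite ler_wpM2l // ltW // laziness_gt0.
have -> : laziness * radius = 2^-1 by rewrite /laziness; have := radius_ge1 => ?; field; lra.
by lra.
Qed.

(** By [psi_sum] the mean of [Psi_on S F] is at least [alpha * #|S|], which exceeds [radius]. *)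
Lemma sublevel_not_full S F : (forall j, j \in S -> F 0 j != 0) -> (s <= #|S|)%N ->
  ~ (forall t, Psi_on S F t <= radius).
Proof.
move=> FS sS h.
have : \sum_t Psi_on S F t <= \sum_(t : 'F_p) radius by apply: ler_sum => t _; apply: h.
rewrite sumr_const card_Fp // -[_ *+ p]mulr_natr; apply/negP; rewrite -ltNge.
rewrite /Psi_on exchange_big /=.
rewrite (eq_bigr (fun=> p%:R * (1 - \sum_a mu a ^+ 2))); last first.
  by move=> j /FS Fj; rewrite psi_sum.
rewrite sumr_const -[_ *+ #|S|]mulr_natr [ltLHS]mulrC -[ltRHS]mulrA ltr_pM2l ?p_gt0 //.
have : alpha <= 1 - \sum_a mu a ^+ 2 by rewrite lerBrDr addrC -lerBrDr.
set X := 1 - _ => hX; apply: (lt_le_trans s_gt).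
have sS' : s%:R <= #|S|%:R :> R by rewrite ler_nat.
have : 0 <= s%:R :> R by rewrite ler0n.
have := alpha_gt0.
by nra.
Qed.

Definition structured F := [exists t, (t != 0) && (Psi_on finset.setT F t <= m)].

(* Halasz's argument: a nonzero [t0] in the sublevel set of level [m] forces the
   sublevel sets to double [i] times before level [radius]. *)
Lemma orth_prob_le_lazy_orth_prob S F : structured F ->
  (forall j, j \in S -> F 0 j != 0) -> (s <= #|S|)%N ->
  orth_prob F <= 4 / 2 ^+ i * lazy_orth_prob S F.
Proof.
move=> /existsP[t0 /andP[t00 ht0]] FS sS; apply: (le_trans (orth_prob_le_T S F)).
apply: (@le_trans _ _ (4 / 2 ^+ i * (p%:R^-1 * (2^-1 * #|T S F radius|%:R)))); last first.
  by rewrite ler_wpM2l ?lazy_orth_prob_ge // divr_ge0 ?exprn_ge0 ?ler0n.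
have ht0' : Psi_on S F t0 <= m by apply: le_trans ht0; apply: Psi_on_sub; apply: finset.subsetT.
have := sublevel_growth (Psi_onN S F) (Psi_onD S F) (i := i) _ t00 ht0' (sublevel_not_full FS sS).
rewrite -/radius => /(_ (le_trans ler01 m_ge1)).
rewrite -(ler_nat R) natrM natrX => h.
have := p_gt0; rewrite -invr_gt0 => p0.
have i0 : 0 < 2 ^+ i :> R by rewrite exprn_gt0.
have -> : 4 / 2 ^+ i * (p%:R^-1 * (2^-1 * #|T S F radius|%:R)) = p%:R^-1 * (2 * (#|T S F radius|%:R / 2 ^+ i)) :> R.
  by field; rewrite p_neq0 (gt_eqF i0).
by rewrite ler_pM2l // ler_pM2l ?ltr0n // ler_pdivlMr // mulrC.
Qed.

(** On this event the relation determines the entry [F 0 k] from the other entries; [sum_mass]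
    exploits this. *)
Definition mass S k F : R :=
  \sum_(z : 'rV['F_p]_n)
    (\prod_j lazy_law S j (z 0 j)) * (dotv z F == 0)%:R * (z 0 k != 0)%:R.

Lemma mass_ge0 S k F : 0 <= mass S k F.
Proof.
apply: sumr_ge0 => z _; rewrite !mulr_ge0 ?ler0n // prodr_ge0 // => j _.
exact: lazy_law_ge0.
Qed.

Lemma expRN1_le : expR (- 1) <= 2^-1 :> R.
Proof.
rewrite expRN lef_pV2 ?posrE ?expR_gt0 //.
by have := expR_ge1Dx (1 : R); lra.
Qed.

(** The Laplace transform for a Chernoff bound: an entry is nonzero with probability at least
    [laziness * alpha], and 1 - exp (-1) is at least 1/2. *)
Lemma lazy_law_exp S j : j \in S ->
  \sum_z lazy_law S j z * expR (- (z != 0)%:R) <= expR (- (laziness * alpha / 2)).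
Proof.
move=> jS.
have e (z : 'F_p) : expR (- (z != 0)%:R) = 1 - (1 - expR (- 1)) * (z != 0)%:R :> R.
  by case: (z != 0); rewrite /= ?oppr0 ?expR0 -?[1%:R]/(1 : R); ring.
under eq_bigr do rewrite e mulrBr mulr1 mulrCA.
rewrite sumrB -mulr_sumr lazy_law_sum1 lazy_law_neq0 jS.
have h := expRN1_le; have hq := laziness_gt0.
have ha : alpha <= 1 - \sum_a mu a ^+ 2 by rewrite lerBrDr addrC -lerBrDr.
apply: le_trans (expR_ge1Dx _).
have h1 : laziness * alpha <= laziness * (1 - \sum_a mu a ^+ 2) by rewrite ler_wpM2l // ltW.
have h2 : 0 <= laziness * alpha by rewrite mulr_ge0 // ltW.
set X := laziness * (1 - _) in h1 *.
by nra.
Qed.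

(* If [N] is the number of nonzero entries then [1 <= exp (kap - N) + N / kap]
   for every [kap > 0]. *)
Lemma lazy_orth_prob_le_mass S F : (0 < #|S|)%N ->
  lazy_orth_prob S F <= expR (- (laziness * alpha * #|S|%:R / 4))
            + (laziness * alpha * #|S|%:R / 4)^-1 * \sum_(k in S) mass S k F.
Proof.
(* A quarter of the lower bound for the mean number of nonzero entries, hence half of the exponent
   gained from [lazy_law_exp]. *)
move=> S0; set kap := laziness * alpha * #|S|%:R / 4.
have kap0 : 0 < kap by rewrite !mulr_gt0 ?laziness_gt0 ?ltr0n // invr_gt0.
pose N (z : 'rV['F_p]_n) : R := \sum_(k in S) (z 0 k != 0)%:R.
have N0 z : 0 <= N z by apply: sumr_ge0.
have pt z : 1 <= expR (kap - N z) + kap^-1 * N z.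
  have [h|h] := lerP kap (N z).
    have : 1 <= kap^-1 * N z by rewrite mulrC ler_pdivlMr // mul1r.
    by have := expR_ge0 (kap - N z); lra.
  have : 0 <= kap^-1 * N z by rewrite mulr_ge0 // invr_ge0 ltW.
  by have := expR_ge1Dx (kap - N z); lra.
have nu0 z : 0 <= \prod_j lazy_law S j (z 0 j) by apply: prodr_ge0 => j _; apply: lazy_law_ge0.
have -> : kap^-1 * \sum_(k in S) mass S k F = \sum_(z : 'rV['F_p]_n)
    (\prod_j lazy_law S j (z 0 j)) * (dotv z F == 0)%:R * (kap^-1 * N z).
  rewrite exchange_big mulr_sumr /=; apply: eq_bigr => z _.
  by rewrite -mulr_sumr mulrCA.
apply: (@le_trans _ _ (\sum_(z : 'rV['F_p]_n)
    ((\prod_j lazy_law S j (z 0 j)) * expR (kap - N z) +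
    (\prod_j lazy_law S j (z 0 j)) * (dotv z F == 0)%:R * (kap^-1 * N z)))).
  apply: ler_sum => z _.
  case: (dotv z F == 0); rewrite -?[true%:R]/(1 : R) -?[false%:R]/(0 : R).
    by rewrite !mulr1 -mulrDr ler_peMr.
  by rewrite mulr0 mul0r addr0 mulr_ge0 ?expR_ge0.
rewrite big_split /= lerD2r.
pose g j (z : 'F_p) : R := if j \in S then expR (- (z != 0)%:R) else 1.
have -> : \sum_(z : 'rV['F_p]_n) (\prod_j lazy_law S j (z 0 j)) * expR (kap - N z)
   = expR kap * \prod_j \sum_z lazy_law S j z * g j z.
  rewrite -sum_rV_prod mulr_sumr; apply: eq_bigr => z _.
  rewrite expRD mulrCA big_split /=; congr (_ * (_ * _)).
  by rewrite /N -sumrN expR_sum /g big_mkcond.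
have -> : expR (- kap) = expR kap * \prod_(j in S) expR (- (laziness * alpha / 2)).
  rewrite prodr_const -expRM_natl -expRD; congr expR.
  by rewrite /kap -mulr_natr; field.
rewrite ler_pM2l ?expR_gt0 // [leRHS]big_mkcond; apply: ler_prod => j _.
rewrite sumr_ge0 /=; last first.
  by move=> z _; rewrite mulr_ge0 ?lazy_law_ge0 // /g; case: ifP => _; rewrite ?expR_ge0.
case: ifPn => jS; rewrite /g.
  by rewrite jS; apply: lazy_law_exp.
rewrite (negPf jS); under eq_bigr do rewrite mulr1.
by rewrite lazy_law_sum1.
Qed.

(** Twice the factor of [orth_prob_le_lazy_orth_prob], to absorb the exponential term, times the
    coefficient in [lazy_orth_prob_le_mass]. *)
Definition mass_coef S : R := 8 / 2 ^+ i * (laziness * alpha * #|S|%:R / 4)^-1.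

Lemma mass_coef_ge0 S : 0 <= mass_coef S.
Proof.
rewrite /mass_coef mulr_ge0 ?divr_ge0 ?exprn_ge0 ?ler0n // invr_ge0.
by rewrite !mulr_ge0 ?(ltW laziness_gt0) ?(ltW alpha_gt0).
Qed.

(** The exponential term is at most 1 / (4 p), half of the lower bound 1 / (2 p) that t = 0 gives
    for [lazy_orth_prob], so it moves to the left side. *)
Lemma orth_prob_le_mass S F : structured F -> (forall j, j \in S -> F 0 j != 0) ->
  (0 < #|S|)%N -> (s <= #|S|)%N ->
  orth_prob F <= mass_coef S * \sum_(k in S) mass S k F.
Proof.
move=> bF FS S0 sS; apply: (le_trans (orth_prob_le_lazy_orth_prob bF FS sS)).
have h1 := lazy_orth_prob_le_mass F S0.
have h2 : expR (- (laziness * alpha * #|S|%:R / 4)) <= (4 * p%:R)^-1.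
  apply: le_trans s_exp; rewrite ler_expR lerN2 ler_pM2r ?invr_gt0 // ler_wpM2l ?ler_nat //.
  by rewrite mulr_ge0 // ltW // laziness_gt0.
have h3 : (2 * p%:R)^-1 <= lazy_orth_prob S F.
  apply: le_trans (lazy_orth_prob_ge S F).
  rewrite invfM mulrC ler_wpM2l ?invr_ge0 ?ler0n // ler_peMr ?invr_ge0 //.
  rewrite -[1]/(1%:R) ler_nat; apply/card_gt0P; exists 0.
  by rewrite inE Psi_on0 (le_trans ler01) // radius_ge1.
have e : (2 * p%:R)^-1 = 2 * (4 * p%:R)^-1 :> R by field; rewrite p_neq0.
rewrite e in h3.
rewrite /mass_coef -[leRHS]mulrA; set X := _^-1 * \sum_(_ in _) _ in h1 *.
have i0 : 0 < (2 ^+ i)^-1 :> R by rewrite invr_gt0 exprn_gt0.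
have -> : 8 / 2 ^+ i * X = 4 / 2 ^+ i * (2 * X) by ring.
rewrite ler_wpM2l ?(mulr_ge0 _ (ltW i0)) ?ler0n //.
by move: h1 h2 h3; set E := expR _; set P := _^-1; lra.
Qed.

Lemma dotvD (z F F' : 'rV['F_p]_n) : dotv z (F + F') = dotv z F + dotv z F'.
Proof. by rewrite /dotv -big_split; apply: eq_bigr => j _; rewrite mxE mulrDr. Qed.

Lemma dotv_delta (z : 'rV['F_p]_n) k x : dotv z (x *: delta_mx 0 k) = z 0 k * x.
Proof.
rewrite /dotv (bigD1 k) //= !mxE !eqxx mulr1 big1 ?addr0 // => j jk.
by rewrite !mxE eqxx (negPf jk) !mulr0.
Qed.

(** Outside [S] the lazy vector vanishes, so the entries of [F] there are irrelevant. *)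
Lemma mass_translate S j k F x : k \notin S ->
  mass S j (F + x *: delta_mx 0 k) = mass S j F.
Proof.
move=> kS; apply: eq_bigr => z _; rewrite dotvD dotv_delta.
have [z0|z0] := eqVneq (z 0 k) 0; first by rewrite z0 mul0r addr0.
by rewrite (bigD1 k) //= {1 3}/lazy_law (negPf kS) (negPf z0) !mul0r.
Qed.

(** If [z 0 k] is nonzero, exactly one [x] makes [z] orthogonal, so the sum is the probability that
    [z 0 k] is nonzero. *)
Lemma sum_mass S k F :
  \sum_x mass S k (F + x *: delta_mx 0 k) <= laziness.
Proof.
rewrite exchange_big /=.
have -> : \sum_(z : 'rV['F_p]_n) \sum_x (\prod_j lazy_law S j (z 0 j)) *
    (dotv z (F + x *: delta_mx 0 k) == 0)%:R * (z 0 k != 0)%:R =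
  \sum_(z : 'rV['F_p]_n) \prod_j (lazy_law S j (z 0 j) *
     (if j == k then (z 0 j != 0)%:R else 1)).
  apply: eq_bigr => z _; rewrite big_split /= -mulr_suml -mulr_sumr -mulrA; congr (_ * _).
  have -> : \prod_j (if j == k then (z 0 j != 0)%:R else 1) = (z 0 k != 0)%:R :> R.
    by rewrite (bigD1 k) //= eqxx big1 ?mulr1 // => j /negPf ->.
  have [z0|z0] := eqVneq (z 0 k) 0; first by rewrite mulr0.
  rewrite mulr1 (bigD1 (- dotv z F / z 0 k)) //= dotvD dotv_delta mulrC divfK // subrr eqxx.
  rewrite big1 ?addr0 // => x xn; rewrite dotvD dotv_delta addr_eq0.
  rewrite (_ : (_ == _) = false) //; apply: contraNF xn => /eqP h.
  by rewrite h opprK [_ * x]mulrC mulfK.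
rewrite (sum_rV_prod (fun j z => lazy_law S j z * (if j == k then (z != 0)%:R else 1))).
rewrite (bigD1 k) //= eqxx [X in _ * X](_ : _ = 1); last first.
  by apply: big1 => j /negPf ->; under eq_bigr do rewrite mulr1; rewrite lazy_law_sum1.
rewrite mulr1 lazy_law_neq0; case: ifP => _; last exact: ltW laziness_gt0.
rewrite ler_piMr ?(ltW laziness_gt0) // lerBlDr lerDl.
by apply: sumr_ge0 => a _; apply: sqr_ge0.
Qed.

(* An upper bound for [orth_prob F ^+ k], a sum over the ordered choices of [k]
   entries of [F]: the first chosen entry occurs in the first factor only, and
   averaging that factor over it gains [1 / p]; then recursively. *)
Fixpoint mass_iter k S F : R :=
  if k is k'.+1 then \sum_(j in S) mass_coef S * mass S j F * mass_iter k' (S :\ j)%SET F else 1.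

Lemma mass_coef_mass_ge0 S j F : 0 <= mass_coef S * mass S j F.
Proof. by apply: mulr_ge0; [apply: mass_coef_ge0|apply: mass_ge0]. Qed.

Lemma mass_iter_ge0 k S F : 0 <= mass_iter k S F.
Proof.
elim: k S => [|k IH] S //=; apply: sumr_ge0 => j _.
by apply: mulr_ge0 (IH _); apply: mass_coef_mass_ge0.
Qed.

Lemma mass_iter_translate k S j F x : j \notin S ->
  mass_iter k S (F + x *: delta_mx 0 j) = mass_iter k S F.
Proof.
elim: k S => [|k IH] S jS //=; apply: eq_bigr => l lS.
by rewrite mass_translate // IH // in_setD1 (negPf jS) andbF.
Qed.

(** Each factor is bounded with the entries chosen so far removed from [S]; the size condition
    leaves at least [s] entries for every factor. *)
Lemma orth_prob_pow_le_mass_iter k S F : structured F -> (forall j, j \in S -> F 0 j != 0) ->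
  (s + k <= #|S|)%N -> orth_prob F ^+ k <= mass_iter k S F.
Proof.
move=> bF; elim: k S => [|k IH] S FS hk; first by rewrite expr0.
rewrite exprS /= (eq_bigr (fun j => (mass_coef S * mass S j F) * mass_iter k (S :\ j)%SET F)) //.
have S0 : (0 < #|S|)%N by lia.
have sS : (s <= #|S|)%N by lia.
have r0 : 0 <= orth_prob F ^+ k by rewrite exprn_ge0 ?orth_prob_ge0.
apply: le_trans (ler_wpM2r r0 (orth_prob_le_mass bF FS S0 sS)) _.
rewrite mulr_sumr mulr_suml; apply: ler_sum => j jS.
apply: ler_wpM2l; [exact: mass_coef_mass_ge0|apply: IH].
  by move=> l; rewrite in_setD1 => /andP[_ /FS].
by move: hk; rewrite (cardsD1 j) jS addnS add1n ltnS.
Qed.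

Variable eps : R.
Hypothesis i_large : 32 / (2 ^+ i * alpha) <= eps.

Lemma eps_gt0 : 0 < eps.
Proof.
apply: lt_le_trans i_large; rewrite divr_gt0 ?ltr0n // mulr_gt0 //.
Qed.

(** [#|S|] and [laziness] cancel, leaving exactly 32 / (2^i alpha). *)
Lemma mass_coef_le S : (0 < #|S|)%N -> #|S|%:R * (mass_coef S * laziness) <= eps.
Proof.
move=> S0; apply: le_trans i_large; rewrite /mass_coef.
have := laziness_gt0; have : 0 < #|S|%:R :> R by rewrite ltr0n.
have : 0 < 2 ^+ i :> R by rewrite exprn_gt0.
have := alpha_gt0; set c := #|S|%:R; set u := 2 ^+ i => a0 u0 c0 q0.
rewrite le_eqVlt; apply/orP; left; apply/eqP; field.
by rewrite !gt_eqF.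
Qed.

(** * Summation over the structured vectors *)

Definition insupp D F : R := \prod_j (if j \in D then 1 else (F 0 j == 0)%:R).

Lemma insupp_ge0 D F : 0 <= insupp D F.
Proof. by apply: prodr_ge0 => j _; case: ifP. Qed.

Lemma insupp_sum D : \sum_F insupp D F = p%:R ^+ #|D|.
Proof.
rewrite (sum_rV_prod (fun j z => if j \in D then 1 else (z == 0)%:R)).
rewrite -prodr_const [RHS]big_mkcond /=; apply: eq_bigr => j _.
case: (j \in D); last exact: sum_eq0_indic.
by rewrite sumr_const card_Fp.
Qed.

Lemma insupp_translate D F j x : j \in D ->
  insupp D (F + x *: delta_mx 0 j) = insupp D F.
Proof.
move=> jD; apply: eq_bigr => l _; case: ifPn => // lD; rewrite !mxE eqxx.
have -> : (l == j) = false by apply/negbTE; apply: contraNneq lD => ->.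
by rewrite mulr0 addr0.
Qed.

Lemma mass_iter_sum k D S : S \subset D ->
  \sum_F insupp D F * mass_iter k S F <= p%:R ^+ #|D| * (eps / p%:R) ^+ k.
Proof.
elim: k S => [|k IH] S SD /=.
  by under eq_bigr do rewrite mulr1; rewrite insupp_sum expr0 mulr1.
set B := p%:R ^+ #|D| * (eps / p%:R) ^+ k.
have B0 : 0 <= B by rewrite mulr_ge0 // exprn_ge0 // divr_ge0 // ltW // eps_gt0.
have step j : j \in S ->
    \sum_F insupp D F * (mass S j F * mass_iter k (S :\ j)%SET F) <= laziness / p%:R * B.
  move=> jS; have jD : j \in D by apply: (fintype.subsetP SD).
  rewrite mulrAC ler_pdivlMr ?p_gt0 // mulrC.
  set X := \sum_F _.
  (* Averaging over translations along [j] changes only the factor [mass S j]: [j] lies in [D] and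
     has been removed from the set of the remaining factor. *)
  have -> : p%:R * X = \sum_F insupp D F * mass_iter k (S :\ j)%SET F *
     (\sum_x mass S j (F + x *: delta_mx 0 j)).
    transitivity (\sum_(x : 'F_p) X); first by rewrite sumr_const card_Fp // mulr_natl.
    rewrite [RHS](eq_bigr (fun F => \sum_x insupp D F * mass_iter k (S :\ j)%SET F * mass S j (F + x *: delta_mx 0 j))); last first.
      by move=> F _; rewrite mulr_sumr.
    rewrite [RHS]exchange_big; apply: eq_bigr => x _ /=.
    rewrite /X (reindex_inj (addIr (x *: delta_mx 0 j))) /=.
    apply: eq_bigr => F _; rewrite insupp_translate // mass_iter_translate ?setD11 //.
    by rewrite mulrA mulrAC.
  apply: (@le_trans _ _ (\sum_F insupp D F * mass_iter k (S :\ j)%SET F * laziness)).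
    apply: ler_sum => F _; rewrite ler_wpM2l ?sum_mass //.
    by rewrite mulr_ge0 ?insupp_ge0 ?mass_iter_ge0.
  rewrite -mulr_suml mulrC ler_wpM2l ?(ltW laziness_gt0) //; apply: IH.
  by apply: (fintype.subset_trans _ SD); apply: subD1set.
have -> : \sum_F insupp D F * (\sum_(j in S) mass_coef S * mass S j F * mass_iter k (S :\ j)%SET F)
   = \sum_(j in S) mass_coef S * \sum_F insupp D F * (mass S j F * mass_iter k (S :\ j)%SET F).
  under eq_bigr do rewrite mulr_sumr.
  rewrite exchange_big /=; apply: eq_bigr => j _; rewrite mulr_sumr.
  by apply: eq_bigr => F _; ring.
apply: (@le_trans _ _ (\sum_(j in S) mass_coef S * (laziness / p%:R * B))).
  by apply: ler_sum => j jS; rewrite ler_wpM2l ?mass_coef_ge0 // step.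
rewrite sumr_const -[_ *+ #|S|]mulr_natl exprS.
have -> : p%:R ^+ #|D| * (eps / p%:R * (eps / p%:R) ^+ k) = eps * (B / p%:R).
  by rewrite /B; ring.
have -> : #|S|%:R * (mass_coef S * (laziness / p%:R * B)) = #|S|%:R * (mass_coef S * laziness) * (B / p%:R) by ring.
rewrite ler_wpM2r ?divr_ge0 //.
have [S0|S0] := posnP #|S|; first by rewrite S0 mul0r ltW // eps_gt0.
exact: mass_coef_le.
Qed.

Hypothesis eps_le : eps <= 1 - alpha / 2.

Definition supp F := [set j | F 0 j != 0]%SET.

Lemma supp_insupp F : insupp (supp F) F = 1.
Proof.
apply: big1 => j _; case: ifPn => //.
by rewrite inE negbK => ->.
Qed.

(** If [#|D|] is at least [s], then [#|D| - s] of the [b] factors are spent on [mass_iter_sum] and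
    the others are at most 1 - alpha / 2. A smaller support has so few vectors that this last bound
    does for all the factors. *)
Lemma structured_sum_supp (b : nat) D : (n <= b + s)%N ->
  \sum_(F | [&& F != 0, structured F & supp F == D]) orth_prob F ^+ b <=
  (p%:R / eps) ^+ s * (eps ^+ #|D| * (1 - alpha / 2) ^+ (n - #|D|)).
Proof.
move=> nbs; set beta := 1 - alpha / 2.
have Dn : (#|D| <= n)%N by rewrite -[X in (_ <= X)%N](card_ord n) max_card.
have e0 := eps_gt0.
have b0 : 0 < beta by apply: lt_le_trans e0 eps_le.
have b1 : beta <= 1 by have := alpha_gt0; rewrite /beta; lra.
have bx k l : (k <= l)%N -> beta ^+ l <= beta ^+ k.
  by move=> kl; rewrite ler_wiXn2l // ltW.
have [sD|Ds] := leqP s #|D|.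
  pose k := (#|D| - s)%N.
  apply: (@le_trans _ _ (\sum_F insupp D F * mass_iter k D F * beta ^+ (b - k))).
    rewrite big_mkcond; apply: ler_sum => F _; case: ifPn => [/and3P[F0 bF /eqP sF]|_]; last first.
      by rewrite !mulr_ge0 ?insupp_ge0 ?mass_iter_ge0 // exprn_ge0 // ltW.
    have -> : insupp D F = 1 by rewrite -sF supp_insupp.
    have kb : (k <= b)%N by clear -Dn nbs sD; rewrite /k; lia.
    rewrite mul1r -(subnKC kb) exprD addKn.
    apply: ler_pM; rewrite ?exprn_ge0 ?orth_prob_ge0 //.
      by apply: orth_prob_pow_le_mass_iter => //; [rewrite -sF => j; rewrite inE|rewrite /k subnKC].
    by apply: lerXn2r; rewrite ?nnegrE ?orth_prob_ge0 ?(ltW b0) // orth_prob_neq0.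
  rewrite -mulr_suml.
  apply: (@le_trans _ _ (p%:R ^+ #|D| * (eps / p%:R) ^+ k * beta ^+ (n - #|D|))).
    apply: ler_pM; rewrite ?mass_iter_sum ?exprn_ge0 ?(ltW b0) //.
      by apply: sumr_ge0 => F _; rewrite mulr_ge0 ?insupp_ge0 ?mass_iter_ge0.
    by apply: bx; clear -Dn nbs sD; rewrite /k; lia.
  rewrite mulrA ler_wpM2r ?exprn_ge0 ?(ltW b0) //.
  rewrite le_eqVlt; apply/orP; left; apply/eqP.
  rewrite -[in LHS](subnK sD) -[in RHS](subnK sD) -/k !exprD !expr_div_n.
  by field; rewrite !expf_neq0 ?p_neq0 ?gt_eqF.
apply: (@le_trans _ _ (\sum_F insupp D F * beta ^+ b)).
  rewrite big_mkcond; apply: ler_sum => F _; case: ifPn => [/and3P[F0 bF /eqP sF]|_]; last first.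
    by rewrite mulr_ge0 ?insupp_ge0 // exprn_ge0 // ltW.
  have -> : insupp D F = 1 by rewrite -sF supp_insupp.
  rewrite mul1r.
  by apply: lerXn2r; rewrite ?nnegrE ?orth_prob_ge0 ?(ltW b0) // orth_prob_neq0.
rewrite -mulr_suml insupp_sum expr_div_n -mulrA.
have p1 : 1 <= p%:R :> R by rewrite -[1]/(1%:R) ler_nat prime_gt0.
apply: ler_pM; rewrite ?exprn_ge0 ?(ltW b0) //; first by rewrite ler_weXn2l // ltnW.
rewrite mulrC ler_pdivlMr ?exprn_gt0 // -(subnK (ltnW Ds)) exprD mulrA [leRHS]mulrC.
rewrite ler_pM2r ?exprn_gt0 //.
apply: (@le_trans _ _ (beta ^+ b * beta ^+ (s - #|D|))).
  rewrite ler_wpM2l ?exprn_ge0 ?(ltW b0) //.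
  by apply: lerXn2r; rewrite ?nnegrE ?(ltW e0) ?(ltW b0).
by rewrite -exprD; apply: bx; clear -Dn nbs Ds; lia.
Qed.

Lemma structured_sum (b : nat) : (n <= b + s)%N ->
  \sum_(F | (F != 0) && structured F) orth_prob F ^+ b <=
  (p%:R / eps) ^+ s * (eps + (1 - alpha / 2)) ^+ n.
Proof.
move=> nbs; rewrite (partition_big supp xpredT) //=.
have h D : \sum_(F | (F != 0) && structured F && (supp F == D)) orth_prob F ^+ b <=
    (p%:R / eps) ^+ s * (eps ^+ #|D| * (1 - alpha / 2) ^+ (n - #|D|)).
  by under eq_bigl do rewrite -andbA; apply: structured_sum_supp.
apply: le_trans (ler_sum _ (fun D _ => h D)) _.
rewrite -mulr_sumr ler_wpM2l ?exprn_ge0 ?divr_ge0 ?(ltW eps_gt0) //.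
(* The sum over the supports [D] is the expansion of a product of [n] equal binomials. *)
rewrite -[X in _ ^+ X](card_ord n) -prodr_const bigA_distr /=.
rewrite le_eqVlt; apply/orP; left; apply/eqP; apply: eq_bigr => D _.
rewrite [RHS](bigID (mem D)) /=; congr (_ * _).
  by rewrite -prodr_const; apply: eq_bigr => j ->.
transitivity (\prod_(j in ~: D) (1 - alpha / 2))%SET.
  by rewrite prodr_const cardsCs finset.setCK card_ord.
by apply: eq_big => [j|j]; rewrite inE // => /negPf ->.
Qed.

End Params.

End Dim.
End Core.

(** * The walk of the codimension *)

Lemma sum_col_mx (T : finType) (S : nmodType) m1 m2 n (f : 'M[T]_(m1 + m2, n) -> S) :
  \sum_(A : 'M[T]_(m1 + m2, n)) f A =
  \sum_(B : 'M[T]_(m1, n)) \sum_(C : 'M[T]_(m2, n)) f (col_mx B C).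
Proof.
rewrite pair_big (reindex (fun u : 'M[T]_(m1, n) * 'M[T]_(m2, n) => col_mx u.1 u.2)) //=.
exists (fun A => (usubmx A, dsubmx A)) => [[B C] _|A _] /=.
  by rewrite col_mxKu col_mxKd.
by rewrite vsubmxK.
Qed.

Section Walk.
Variables (R : realType) (p : nat) (chi : 'F_p -> R[i]).
Hypothesis p_pr : prime p.
Hypothesis chiD : forall x y, chi (x + y) = chi x * chi y.
Hypothesis chi_norm : forall x, Normc.normc (chi x) = 1.
Hypothesis chi_sum : forall y, \sum_x chi (x * y) = if y == 0 then p%:R else 0.
Variable mu : 'F_p -> R.
Hypothesis mu_ge0 : forall a, 0 <= mu a.
Hypothesis mu_sum1 : \sum_a mu a = 1.
Local Notation normc := Normc.normc.

Lemma dotvE n (u v : 'rV['F_p]_n) : dotv u v = (u *m v^T) 0 0.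
Proof. by rewrite !mxE; apply: eq_bigr => j _; rewrite mxE. Qed.

Lemma dotv_mulmx n (u v : 'rV['F_p]_n) (K : 'M['F_p]_n) : dotv (u *m K) v = dotv u (v *m K^T).
Proof. by rewrite !dotvE trmx_mul trmxK mulmxA. Qed.

Lemma chi_dot_sum n (u : 'rV['F_p]_n) :
  \sum_(y : 'rV['F_p]_n) chi (dotv u y) = if u == 0 then p%:R ^+ n else 0.
Proof.
have -> : \sum_(y : 'rV['F_p]_n) chi (dotv u y) = \prod_j \sum_a chi (a * u 0 j).
  rewrite -sum_rV_prod; apply: eq_bigr => y _.
  by rewrite (chi_prod chiD chi_norm); apply: eq_bigr => j _; rewrite mulrC.
under eq_bigr do rewrite chi_sum.
case: eqP => [->|/eqP u0].
  by under eq_bigr do rewrite mxE eqxx; rewrite prodr_const card_ord.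
have [j uj] : exists j, u 0 j != 0.
  by apply/existsP; apply: contraNT u0 => /existsPn h; apply/eqP/rowP => j; rewrite mxE; apply/eqP/negPn/h.
by rewrite (bigD1 j) //= (negPf uj) mul0r.
Qed.

Definition rweight n (v : 'rV['F_p]_n) : R := \prod_j mu (v 0 j).

Lemma rweight_ge0 n (v : 'rV['F_p]_n) : 0 <= rweight v.
Proof. exact: prodr_ge0. Qed.

Lemma rweight_sum n : \sum_(v : 'rV['F_p]_n) rweight v = 1.
Proof. by rewrite (sum_rV_prod (fun=> mu)) big1. Qed.

Variable delta : R.
Hypothesis delta_ge0 : 0 <= delta.

Definition spread n (U : 'M['F_p]_n) := forall F : 'rV['F_p]_n,
  F != 0 -> U *m F^T = 0 -> normc (\prod_j fourier chi mu (F 0 j)) <= delta.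

Lemma card_left_kernel n (K : 'M['F_p]_n) :
  #|[pred y : 'rV['F_p]_n | y *m K == 0]| = (p ^ (n - \rank K))%N.
Proof.
have := card_rowg (kermx K); rewrite card_Fp // mxrank_ker => <-.
by apply: eq_card => y; rewrite mem_rowg inE; apply/eqP/sub_kermxP.
Qed.

(** Membership in [U] means being killed by [K], which is detected by averaging characters over [y].
    The [p ^ \rank U] vectors [y] with [y *m K^T = 0] give the main term; the others give nonzero
    vectors orthogonal to [U]. *)
Lemma prob_in_space n (U : 'M['F_p]_n) : spread U ->
  `|\sum_(v | (v <= U)%MS) rweight v - p%:R ^- (n - \rank U)| <= delta.
Proof.
move=> gU; set pr := \sum_(v | _) _; set K := cokermx U.
have rU : (\rank U <= n)%N by apply: rank_leq_row.
have pn0 : p%:R ^+ n != 0 :> R by rewrite expf_neq0 // p_neq0.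
have pn_gt0 : 0 < p%:R ^+ n :> R by rewrite exprn_gt0 // p_gt0.
have e1 : (pr * p%:R ^+ n)%:C%C =
    \sum_(y : 'rV['F_p]_n) \prod_j fourier chi mu ((y *m K^T) 0 j).
  under eq_bigr => y _.
    rewrite -(fourier_prod chiD chi_norm).
    over.
  rewrite exchange_big /= /pr mulr_suml big_mkcond rmorph_sum; apply: eq_bigr => v _ /=.
  rewrite -mulr_sumr (eq_bigr (fun y => chi (dotv (v *m K) y))); last first.
    by move=> y _; rewrite dotv_mulmx.
  rewrite chi_dot_sum submxE -/K; case: ifP => _; last by rewrite mulr0.
  by rewrite rmorphM rmorphXn /= rmorph_nat.
have e2 : (pr * p%:R ^+ n - p%:R ^+ \rank U)%:C%C =
    \sum_(y : 'rV['F_p]_n | y *m K^T != 0) \prod_j fourier chi mu ((y *m K^T) 0 j).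
  have e3 : \sum_(y : 'rV['F_p]_n | y *m K^T == 0) \prod_j fourier chi mu ((y *m K^T) 0 j)
      = (p%:R ^+ \rank U)%:C%C.
    have f0 : fourier chi mu 0 = 1.
      rewrite /fourier; under eq_bigr do rewrite mul0r (chi0 chiD chi_norm) mulr1.
      by rewrite -rmorph_sum mu_sum1.
    rewrite (eq_bigr (fun=> 1)); last first.
      by move=> y /eqP ->; apply: big1 => j _; rewrite mxE f0.
    rewrite sumr_const card_left_kernel mxrank_tr mxrank_coker subKn //.
    by rewrite natrX rmorphXn /= rmorph_nat.
  rewrite rmorphB /= e1 (bigID (fun y : 'rV['F_p]_n => y *m K^T == 0)) /= e3.
  by rewrite addrAC subrr add0r.
have h : normc (pr * p%:R ^+ n - p%:R ^+ \rank U)%:C%C <= delta * p%:R ^+ n.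
  rewrite e2; apply: (le_trans (normc_sum _ _)).
  apply: (@le_trans _ _ (\sum_(y : 'rV['F_p]_n) delta)); last first.
    rewrite sumr_const card_mx card_Fp // mul1n -[_ *+ _]mulr_natr.
    by rewrite natrX.
  rewrite [leLHS]big_mkcond; apply: ler_sum => y _; case: ifPn => yK.
    apply: gU => //.
    rewrite trmx_mul trmxK mulmxA mulmx_coker mul0mx //.
  exact: delta_ge0.
rewrite normc_real in h.
rewrite -(ler_pM2r pn_gt0) -{1}(gtr0_norm pn_gt0) -normrM mulrBl.
suff -> : p%:R ^- (n - \rank U) * p%:R ^+ n = p%:R ^+ \rank U :> R by [].
have -> : p%:R ^+ n = p%:R ^+ (n - \rank U) * p%:R ^+ \rank U :> R by rewrite -exprD subnK.
by rewrite mulKf // expf_neq0 // p_neq0.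
Qed.

Definition mweight m n (A : 'M['F_p]_(m, n)) : R := \prod_i rweight (row i A).

Lemma mweight_ge0 m n (A : 'M['F_p]_(m, n)) : 0 <= mweight A.
Proof. by apply: prodr_ge0 => i _; apply: rweight_ge0. Qed.

Lemma mweight_sum m n : \sum_(A : 'M['F_p]_(m, n)) mweight A = 1.
Proof. by rewrite (sum_mx_prod (fun=> @rweight n)) big1 // => i _; apply: rweight_sum. Qed.

Lemma mweight_col_mx m1 m2 n (A : 'M['F_p]_(m1, n)) (B : 'M['F_p]_(m2, n)) :
  mweight (col_mx A B) = mweight A * mweight B.
Proof.
rewrite /mweight big_split_ord /=.
by congr (_ * _); apply: eq_bigr => i _; congr rweight; apply/rowP => j;
  rewrite [LHS]mxE [RHS]mxE ?col_mxEu ?col_mxEd.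
Qed.

Lemma mweight_rV n (v : 'rV['F_p]_n) : mweight v = rweight v.
Proof.
by rewrite /mweight big_ord1; congr rweight; apply/rowP => j; rewrite mxE.
Qed.

Lemma mweight_tr m n (A : 'M['F_p]_(m, n)) : mweight A^T = mweight A.
Proof.
rewrite /mweight /rweight exchange_big /=; apply: eq_bigr => i _.
by apply: eq_bigr => j _; rewrite !mxE.
Qed.

Section Chain.
Variables (n d : nat).

(* [walk j U] is the probability that [U] and [j] random rows span a space of
   codimension [d]; [ideal j k] is what it would be, for [U] of codimension
   [d + k], if a row fell into a space of codimension [l] with probability
   exactly [p ^- l]. *)
Fixpoint walk j (U : 'M['F_p]_n) : R :=
  if j is j'.+1 then \sum_v rweight v * walk j' (U + v)%MS
  else (\rank U + d == n)%N%:R.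

Fixpoint ideal j k : R :=
  match j, k with
  | 0, k => (k == 0)%:R
  | j'.+1, 0 => p%:R ^- d * ideal j' 0
  | j'.+1, k'.+1 => p%:R ^- (d + k) * ideal j' k + (1 - p%:R ^- (d + k)) * ideal j' k'
  end.

Lemma invpX01 l : 0 <= (p%:R ^- l : R) <= 1.
Proof.
rewrite invr_ge0 exprn_ge0 ?ler0n //= invf_le1 ?exprn_gt0 ?p_gt0 //.
by rewrite exprn_ege1 // ler1n prime_gt0.
Qed.

Lemma ideal01 j k : 0 <= ideal j k <= 1.
Proof.
elim: j k => [|j IH] [|k] //=; rewrite ?ler01 ?lexx //.
  by have := invpX01 d; have := IH 0%N; nra.
by have := invpX01 (d + k.+1); have := IH k.+1; have := IH k; nra.
Qed.

Lemma walkE j (U : 'M['F_p]_n) :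
  \sum_(A : 'M['F_p]_(j, n)) mweight A * (\rank (U + A)%MS + d == n)%N%:R = walk j U.
Proof.
elim: j U => [|j IH] U /=.
  rewrite (big_pred1 0) => [|A]; last by rewrite /= (flatmx0 A) eqxx.
  by rewrite /mweight big_ord0 mul1r addsmx0.
rewrite -[j.+1]add1n sum_col_mx; apply: eq_bigr => v _.
rewrite -IH mulr_sumr; apply: eq_bigr => B _.
rewrite mweight_col_mx mweight_rV -mulrA; congr (_ * (_ * _ %:R)).
congr (nat_of_bool (_ + _ == _)); apply: eqmx_rank.
by rewrite -addsmxA; apply/eqmxP; apply: adds_eqmx => //; apply: eqmx_sym; apply: addsmxE.
Qed.

Lemma walk01 j U : 0 <= walk j U <= 1.
Proof.
elim: j U => [|j IH] U /=; first by rewrite ler0n lern1 leq_b1.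
rewrite sumr_ge0 /=; last by move=> v _; rewrite mulr_ge0 ?rweight_ge0 //; case/andP: (IH (U + v)%MS).
rewrite -(rweight_sum n); apply: ler_sum => v _.
by rewrite ler_piMr ?rweight_ge0 //; case/andP: (IH (U + v)%MS).
Qed.

Lemma walk_small j U : (n < \rank U + d)%N -> walk j U = 0.
Proof.
elim: j U => [|j IH] U h /=; first by rewrite gtn_eqF.
rewrite big1 // => v _; rewrite IH ?mulr0 //.
by apply: leq_trans h _; rewrite leq_add2r mxrankS // addsmxSl.
Qed.

Lemma spread_adds (U : 'M['F_p]_n) (v : 'rV['F_p]_n) : spread U -> spread (U + v)%MS.
Proof.
move=> gU F F0 h; apply: gU => //.
have /submxP[D ->] := addsmxSl U v.
by rewrite -mulmxA h mulmx0.
Qed.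

Lemma rank_adds_row (U : 'M['F_p]_n) (v : 'rV['F_p]_n) :
  ~~ (v <= U)%MS -> \rank (U + v)%MS = (\rank U).+1.
Proof.
move=> vU; apply/eqP; rewrite eqn_leq; apply/andP; split.
  by apply: leq_trans (mxrank_adds_leqif _ _) _; rewrite -[leqRHS]addn1 leq_add2l rank_leq_row.
rewrite ltn_neqAle mxrankS ?addsmxSl // andbT; apply: contra vU => h.
have : (U + v <= U)%MS by rewrite -(geq_leqif (mxrank_leqif_sup (addsmxSl U v))) (eqP h).
by rewrite addsmx_sub => /andP[].
Qed.

Lemma idealS j k : ideal j.+1 k = p%:R ^- (d + k) * ideal j k
  + (1 - p%:R ^- (d + k)) * (if k is k'.+1 then ideal j k' else 0).
Proof. by case: k => //=; rewrite mulr0 addr0 addn0. Qed.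

(** Each row costs one [delta]: by [prob_in_space] the probability of falling into the span is off
    by at most [delta], and it multiplies a difference of numbers in [0, 1]. Adding rows preserves
    [spread], since the orthogonal shrinks. *)
Lemma walk_ideal j k U : spread U -> (\rank U + d + k = n)%N ->
  `|walk j U - ideal j k| <= j%:R * delta.
Proof.
elim: j k U => [|j IH] k U gU hk.
  have -> : ideal 0 k = (\rank U + d == n)%N%:R.
    by congr (nat_of_bool _)%:R; apply/eqP/eqP; clear -hk; lia.
  by rewrite /= mul0r subrr normr0.
set x : R := \sum_(v | (v <= U)%MS) rweight v.
have xb := prob_in_space gU; rewrite -/x (_ : n - \rank U = d + k)%N in xb; last by lia.
have x01 : 0 <= x <= 1.
  rewrite sumr_ge0 /=; last by move=> v _; apply: rweight_ge0.
  rewrite -(rweight_sum n) [leRHS](bigID (fun v => (v <= U)%MS)) /= lerDl.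
  by apply: sumr_ge0 => v _; apply: rweight_ge0.
(* At codimension [d] a row outside the span is fatal, since the codimension never grows again;
   hence the value 0. *)
pose y k' : R := if k' is k''.+1 then ideal j k'' else 0.
have xC : 1 - x = \sum_(v | ~~ (v <= U)%MS) rweight v.
  by rewrite -(rweight_sum n) (bigID (fun v => (v <= U)%MS)) /= addrC addrK.
have s1 : `|\sum_v rweight v * walk j (U + v)%MS - (x * ideal j k + (1 - x) * y k)| <= j%:R * delta.
  rewrite (bigID (fun v => (v <= U)%MS)) /= xC /x !mulr_suml opprD addrACA -!sumrB.
  apply: (le_trans (ler_normD _ _)).
  have -> : j%:R * delta = \sum_(v : 'rV_n) rweight v * (j%:R * delta).
    by rewrite -mulr_suml rweight_sum mul1r.
  rewrite [leRHS](bigID (fun v => (v <= U)%MS)) /=; apply: lerD.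
    apply: (le_trans (ler_norm_sum _ _ _)); apply: ler_sum => v vU.
    rewrite -mulrBr normrM (ger0_norm (rweight_ge0 v)) ler_wpM2l ?rweight_ge0 //.
    apply: IH; first exact: spread_adds.
    by rewrite (addsmx_idPl vU).
  apply: (le_trans (ler_norm_sum _ _ _)); apply: ler_sum => v vU.
  rewrite -mulrBr normrM (ger0_norm (rweight_ge0 v)) ler_wpM2l ?rweight_ge0 //.
  rewrite /y; case: (k) hk => [|k'] hk.
    rewrite walk_small ?rank_adds_row // ?subrr ?normr0 ?mulr_ge0 ?ler0n //.
    by lia.
  apply: IH; first exact: spread_adds.
  by rewrite rank_adds_row //; lia.
rewrite idealS -/(y k) -[walk j.+1 U]/(\sum_v rweight v * walk j (U + v)%MS).
set P := p%:R ^- (d + k) in xb *; set S := \sum_v _ in s1 *.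
have -> : S - (P * ideal j k + (1 - P) * y k) =
  S - (x * ideal j k + (1 - x) * y k) + (x - P) * (ideal j k - y k) by ring.
apply: (le_trans (ler_normD _ _)).
rewrite -natr1 [leRHS]mulrDl [X in _ <= _ + X]mul1r lerD // normrM.
have y01 : 0 <= y k <= 1 by rewrite /y; case: (k) => [|k'] /=; rewrite ?lexx ?ler01 ?ideal01.
have : `|ideal j k - y k| <= 1 by rewrite ler_norml; have := ideal01 j k; lra.
by have := normr_ge0 (x - P); have := normr_ge0 (ideal j k - y k); nra.
Qed.

End Chain.
End Walk.

(** * Comparison with the ideal walk *)

Section Assembly.
Variables (R : realType) (p : nat) (chi : 'F_p -> R[i]).
Hypothesis p_pr : prime p.
Hypothesis chiD : forall x y, chi (x + y) = chi x * chi y.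
Hypothesis chi_norm : forall x, Normc.normc (chi x) = 1.
Hypothesis chi_sum : forall y, \sum_x chi (x * y) = if y == 0 then p%:R else 0.
Variable mu : 'F_p -> R.
Hypothesis mu_ge0 : forall a, 0 <= mu a.
Hypothesis mu_sum1 : \sum_a mu a = 1.
Variable m : R.
Local Notation normc := Normc.normc.
Local Notation delta := (expR (- (m / 2))).

Lemma Psi_on_unstructured n (F : 'rV['F_p]_n) t : ~~ structured chi mu m F -> t != 0 ->
  m <= Psi_on chi mu finset.setT F t.
Proof.
move=> /existsPn /(_ t) + t0; rewrite t0 /= -ltNge; exact: ltW.
Qed.

Lemma spread_unstructured n (U : 'M['F_p]_n) :
  (forall F : 'rV['F_p]_n, F != 0 -> U *m F^T = 0 -> ~~ structured chi mu m F) ->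
  spread chi mu delta U.
Proof.
move=> h F F0 UF; rewrite normc_prod.
apply: (@le_trans _ _ (expR (- (Psi_on chi mu finset.setT F 1 / 2)))); last first.
  by rewrite ler_expR lerN2 ler_pM2r ?invr_gt0 // Psi_on_unstructured ?oner_neq0 ?h.
rewrite /Psi_on mulr_suml -sumrN expR_sum.
rewrite [leRHS](eq_bigl xpredT); last by move=> j; rewrite inE.
apply: ler_prod => j _; rewrite normc_ge0 mul1r /=.
exact: fourier_le.
Qed.

(** The frequency t = 0 contributes 1 / p, and each other one at most delta / p. *)
Lemma orth_prob_unstructured n (F : 'rV['F_p]_n) : ~~ structured chi mu m F ->
  orth_prob mu F <= p%:R^-1 + delta.
Proof.
move=> bF.
apply: (le_trans (orth_prob_le_exp p_pr chiD chi_norm chi_sum mu_ge0 mu_sum1 finset.setT F)).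
have h : \sum_t expR (- (Psi_on chi mu finset.setT F t / 2)) <= 1 + p%:R * delta.
  rewrite (bigD1 0) //= lerD //.
    by rewrite Psi_on0 // mul0r oppr0 expR0.
  apply: (@le_trans _ _ (\sum_(t : 'F_p | t != 0) delta)).
    apply: ler_sum => t t0; rewrite ler_expR lerN2 ler_pM2r ?invr_gt0 //.
    exact: Psi_on_unstructured.
  apply: (@le_trans _ _ (\sum_(t : 'F_p) delta)).
    by rewrite [leRHS](bigD1 0) //= lerDr expR_ge0.
  by rewrite sumr_const card_Fp // mulr_natl.
apply: (@le_trans _ _ (p%:R^-1 * (1 + p%:R * delta))).
  by rewrite ler_wpM2l ?invr_ge0 ?ler0n.
by rewrite mulrDr mulr1 mulKf // p_neq0.
Qed.

Lemma prob_right_kernel k n (F : 'rV['F_p]_n) :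
  \sum_(A : 'M['F_p]_(k, n)) mweight mu A * (A *m F^T == 0)%:R = orth_prob mu F ^+ k.
Proof.
transitivity (\sum_(A : 'M['F_p]_(k, n)) \prod_i
    (rweight mu (row i A) * (dotv (row i A) F == 0)%:R)).
  apply: eq_bigr => A _; rewrite big_split /=; congr (_ * _).
  have [e|ne] := eqVneq (A *m F^T) 0.
    rewrite big1 // => i _.
    by rewrite dotvE -row_mul e row0 mxE eqxx.
  have [i hi] : exists i, row i (A *m F^T) != 0.
    by apply/existsP; apply: contraNT ne => /existsPn h; apply/eqP/row_matrixP => i; rewrite row0; apply/eqP/negPn/h.
  rewrite (bigD1 i) //= dotvE -row_mul.
  case: eqP => [h|_]; last by rewrite mul0r.
  by case/negP: hi; apply/eqP/rowP => j; rewrite [j]ord1 h [in RHS]mxE.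
rewrite (sum_mx_prod (fun=> fun v => rweight mu v * (dotv v F == 0)%:R)).
by rewrite prodr_const card_ord.
Qed.

Lemma prob_left_kernel k n (y : 'rV['F_p]_k) :
  \sum_(A : 'M['F_p]_(k, n)) mweight mu A * (y *m A == 0)%:R = orth_prob mu y ^+ n.
Proof.
rewrite -prob_right_kernel (reindex (@trmx _ n k)) /=; last first.
  by exists (@trmx _ k n) => A _; rewrite trmxK.
apply: eq_bigr => A _; rewrite mweight_tr; congr (_ * _%:R).
by rewrite -(inj_eq trmx_inj) trmx_mul trmxK trmx0.
Qed.

(** [walk_ideal] applies when the first [N] rows are independent and have no structured vector in
    their orthogonal. Otherwise the error, at most 1, is paid by one of the counts [e1] and [e2],
    whose means are the two sums. *)
Lemma rank_prob_approx N r d : (d <= r)%N ->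
  `|\sum_(A : 'M['F_p]_(N + r, N + r)) mweight mu A * (\rank A + d == N + r)%N%:R
    - ideal R p d r (r - d)| <=
  r%:R * delta + \sum_(F : 'rV['F_p]_(N + r) | (F != 0) && structured chi mu m F) orth_prob mu F ^+ N
  + \sum_(y : 'rV['F_p]_N | y != 0) orth_prob mu y ^+ (N + r).
Proof.
move=> dr; set f := ideal _ _ _ _ _; set n := (N + r)%N.
pose e1 (A : 'M['F_p]_(N, n)) : R :=
  \sum_(F : 'rV['F_p]_n | (F != 0) && structured chi mu m F) (A *m F^T == 0)%:R.
pose e2 (A : 'M['F_p]_(N, n)) : R := \sum_(y : 'rV['F_p]_N | y != 0) (y *m A == 0)%:R.
have f01 : 0 <= f <= 1 by apply: ideal01.
have e1_ge0 A : 0 <= e1 A by apply: sumr_ge0.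
have e2_ge0 A : 0 <= e2 A by apply: sumr_ge0.
have d0 := expR_ge0 (- (m / 2)).
have pt (A : 'M['F_p]_(N, n)) : `|walk mu d r <<A>>%MS - f| <= r%:R * delta + e1 A + e2 A.
  have le1 : `|walk mu d r <<A>>%MS - f| <= 1.
    by rewrite ler_norml; have := walk01 mu_ge0 mu_sum1 d r <<A>>%MS; lra.
  have rd0 : 0 <= r%:R * delta by rewrite mulr_ge0 ?ler0n.
  have [/existsP[F /andP[Fb AF]]|/existsPn h1] :=
      boolP [exists F : 'rV['F_p]_n, ((F != 0) && structured chi mu m F) && (A *m F^T == 0)].
    have : 1 <= e1 A by rewrite /e1 (bigD1 F) //= AF lerDl; apply: sumr_ge0.
    by have := e2_ge0 A; lra.
  have [/existsP[y /andP[y0 yA]]|/existsPn h2] :=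
      boolP [exists y : 'rV['F_p]_N, (y != 0) && (y *m A == 0)].
    have : 1 <= e2 A by rewrite /e2 (bigD1 y) //= yA lerDl; apply: sumr_ge0.
    by have := e1_ge0 A; lra.
  have rA : \rank A = N.
    apply/eqP; rewrite -/(row_free A) -kermx_eq0; apply/negPn/negP => kA.
    have [i hi] : exists i, row i (kermx A) != 0.
      by apply/existsP; apply: contraNT kA => /existsPn h; apply/eqP/row_matrixP => i; rewrite row0; apply/eqP/negPn/h.
    by have := h2 (row i (kermx A)); rewrite hi -row_mul mulmx_ker row0 eqxx.
  have gA : spread chi mu delta <<A>>%MS.
    apply: spread_unstructured => F F0 AF; apply/negP => Fb; have := h1 F; rewrite F0 Fb /=.
    have /submxP[D ->] : (A <= <<A>>)%MS by rewrite genmxE.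
    by rewrite -mulmxA AF mulmx0 eqxx.
  have hk : (\rank <<A>>%MS + d + (r - d) = n)%N.
    by rewrite genmxE rA -addnA subnKC.
  have := walk_ideal p_pr chiD chi_norm chi_sum mu_ge0 mu_sum1 d0 r gA hk.
  by have := e1_ge0 A; have := e2_ge0 A; rewrite -/f; lra.
have -> : \sum_(A : 'M['F_p]_(N + r, N + r)) mweight mu A * (\rank A + d == N + r)%N%:R =
    \sum_(A : 'M['F_p]_(N, n)) mweight mu A * walk mu d r <<A>>%MS.
  rewrite sum_col_mx; apply: eq_bigr => A _; rewrite -walkE mulr_sumr.
  apply: eq_bigr => B _; rewrite mweight_col_mx -mulrA; congr (_ * (_ * _%:R)).
  congr (nat_of_bool (_ + _ == _)).
  rewrite -addsmxE; apply: eqmx_rank; apply/eqmxP.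
  by apply: adds_eqmx => //; apply: eqmx_sym; apply: genmxE.
have -> : f = \sum_(A : 'M['F_p]_(N, n)) mweight mu A * f.
  by rewrite -mulr_suml mweight_sum // mul1r.
rewrite -sumrB; apply: (le_trans (ler_norm_sum _ _ _)).
have -> : r%:R * delta = \sum_(A : 'M['F_p]_(N, n)) mweight mu A * (r%:R * delta).
  by rewrite -mulr_suml mweight_sum // mul1r.
have -> : \sum_(F : 'rV['F_p]_n | (F != 0) && structured chi mu m F) orth_prob mu F ^+ N =
    \sum_(A : 'M['F_p]_(N, n)) mweight mu A * e1 A.
  under eq_bigr do rewrite -prob_right_kernel.
  by rewrite exchange_big /=; apply: eq_bigr => A _; rewrite mulr_sumr.
have -> : \sum_(y : 'rV['F_p]_N | y != 0) orth_prob mu y ^+ n =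
    \sum_(A : 'M['F_p]_(N, n)) mweight mu A * e2 A.
  under eq_bigr do rewrite -prob_left_kernel.
  by rewrite exchange_big /=; apply: eq_bigr => A _; rewrite mulr_sumr.
rewrite -!big_split /=; apply: ler_sum => A _.
rewrite -mulrBr -!mulrDr normrM ger0_norm ?mweight_ge0 //.
by rewrite ler_wpM2l ?mweight_ge0.
Qed.

End Assembly.

(** * The ideal walk and its limit *)

Section QProducts.
Variables (R : realType) (p : nat).
Hypothesis p_pr : prime p.

Local Notation x := (p%:R^-1 : R).

Lemma invp_gt0 : 0 < x. Proof. by rewrite invr_gt0 ltr0n prime_gt0. Qed.

Lemma invp_le : x <= 2^-1.
Proof. by rewrite lef_pV2 ?posrE ?ltr0n ?prime_gt0 // ler_nat prime_gt1. Qed.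

(** The q-Pochhammer symbol (q^(a+1); q)_k at q = 1 / p. *)
Definition qprod a k : R := \prod_(i < k) (1 - x ^+ (a + i).+1).

Lemma qprod_recr a k : qprod a k.+1 = qprod a k * (1 - x ^+ (a + k).+1).
Proof. by rewrite /qprod big_ord_recr. Qed.

Lemma qprodD a k l : qprod a (k + l) = qprod a k * qprod (a + k) l.
Proof.
elim: l => [|l IH]; first by rewrite addn0 /qprod [X in _ * X]big_ord0 mulr1.
by rewrite addnS !qprod_recr IH mulrA addnA.
Qed.

Lemma invpX_gt0 k : 0 < x ^+ k. Proof. by rewrite exprn_gt0 // invp_gt0. Qed.

Lemma invpXS_le k : x ^+ k.+1 <= 2^-1 * x ^+ k.
Proof. by rewrite exprS ler_wpM2r ?invp_le // ltW // invpX_gt0. Qed.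

Lemma invpX_le1 k : x ^+ k <= 1.
Proof. by rewrite exprn_ile1 ?ltW ?invp_gt0 //; have := invp_le; lra. Qed.

Lemma qprod_gt0 a k : 0 < qprod a k.
Proof.
apply: prodr_gt0 => i _; have := invpXS_le (a + i); have := invpX_le1 (a + i); lra.
Qed.

Lemma qprod_le1 a k : qprod a k <= 1.
Proof.
apply: prodr_ile1 => i _; have := invpXS_le (a + i); have := invpX_le1 (a + i).
by have := invpX_gt0 (a + i).+1; lra.
Qed.

(** Since x is at most 1/2, x^(l+1) is at most x^l - x^(l+1) and the losses telescope; the term
    x^(a+k) carries the induction. *)
Lemma qprod_ge a k : 1 - x ^+ a + x ^+ (a + k) <= qprod a k.
Proof.
elim: k => [|k IH]; first by rewrite addn0 /qprod big_ord0; lra.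
rewrite qprod_recr addnS.
have := invpXS_le (a + k); have := invpX_le1 (a + k); have := invpX_gt0 (a + k).+1.
have := invpX_gt0 (a + k); have := invpX_le1 a; have := invpX_gt0 a.
move: IH (qprod_le1 a k); set u := x ^+ a; set v := x ^+ (a + k); set w := x ^+ _.+1.
by set q := qprod a k; nra.
Qed.

Lemma qprod0_ge d : x ^+ d <= qprod 0 d.
Proof.
elim: d => [|d IH]; first by rewrite expr0 /qprod big_ord0.
rewrite qprod_recr [leLHS]exprSr; apply: ler_pM => //; rewrite ?(ltW invp_gt0) ?(ltW (invpX_gt0 _)) //.
have := invpXS_le (0 + d); have := invpX_le1 (0 + d); have := invp_le; lra.
Qed.

Lemma qprod_rev d k : \prod_(i < k) (1 - x ^+ (d + k - i)) = qprod d k.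
Proof.
rewrite (reindex_inj rev_ord_inj) /=; apply: eq_bigr => i _.
by congr (1 - _ ^+ _); have := ltn_ord i; lia.
Qed.

(* For [j < k] the last product contains the factor [1 - x ^+ 0 = 0], so the
   truncated subtractions are harmless. *)
Lemma idealE d j k : ideal R p d j k =
  x ^+ (d * (j - k)) * (qprod d k / qprod 0 k) * \prod_(i < k) (1 - x ^+ (j - i)).
Proof.
have xV l : p%:R ^- l = x ^+ l by rewrite exprVn.
have q0 k' : qprod 0 k' != 0 by rewrite gt_eqF // qprod_gt0.
elim: j k => [|j IH] k.
  case: k => [|k] /=.
    by rewrite /qprod !big_ord0 subnn muln0 expr0 invr1 !mulr1.
  by rewrite big_ord_recl sub0n expr0 subrr mul0r mulr0.
rewrite idealS xV; case: k => [|k].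
  rewrite mulr0 addr0 addn0 IH /qprod !big_ord0 !subn0 mulnS exprD.
  by rewrite -!mulrA.
have e : \prod_(i < k.+1) (1 - x ^+ (j.+1 - i)) =
    (1 - x ^+ j.+1) * \prod_(i < k) (1 - x ^+ (j - i)).
  by rewrite big_ord_recl subn0; congr (_ * _); apply: eq_bigr => i _; rewrite lift0 subSS.
rewrite !IH e subSS big_ord_recr /= !qprod_recr add0n {e}.
set B := \prod_(i < k) _.
have h1 : 1 - x ^+ k.+1 != 0.
  by rewrite gt_eqF //; have := invpXS_le k; have := invpX_le1 k; lra.
(* For k < j this reduces to x^(k+1) (1 - x^(j-k)) + (1 - x^(k+1)) = 1 - x^(j+1). For k > j all
   terms vanish, and for k = j the first one does. *)
have [kj|jk|kj] := ltngtP k j.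
- have -> : (d * (j - k) = d + d * (j - k.+1))%N by rewrite -mulnS -subSn.
  have e : x ^+ j.+1 = x ^+ k.+1 * x ^+ (j - k) by rewrite -exprD; congr (_ ^+ _); lia.
  rewrite e -!addnS !exprD.
  by field; rewrite h1 q0.
- have -> : B = 0.
    by rewrite /B (bigD1 (Ordinal jk)) //= subnn expr0 subrr mul0r.
  by rewrite !(mul0r, mulr0) addr0.
rewrite /B -kj subnn !muln0 !expr0 subrr !mulr0 add0r !mul1r -!addnS.
by field; rewrite h1 q0.
Qed.

(** This is the law of the corank of a uniform r x r matrix. The two ways of splitting [qprod 0 r]
    exchange the denominators. *)
Lemma ideal_qprod d r : (d <= r)%N ->
  ideal R p d r (r - d) = x ^+ (d ^ 2)%N * (qprod d (r - d) * qprod (r - d) d / qprod 0 d).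
Proof.
move=> dr; rewrite idealE subKn // mulnn.
have -> : \prod_(i < r - d) (1 - x ^+ (r - i)) = qprod d (r - d).
  by rewrite -qprod_rev; apply: eq_bigr => i _; rewrite subnKC.
set k := (r - d)%N.
have q0 k' : qprod 0 k' != 0 by rewrite gt_eqF // qprod_gt0.
have e : qprod 0 k * qprod k d = qprod 0 d * qprod d k.
  by have h1 := qprodD 0 k d; have h2 := qprodD 0 d k; rewrite !add0n in h1 h2; rewrite -h1 -h2 addnC.
have -> : qprod k d = qprod 0 d * qprod d k / qprod 0 k by rewrite -e mulrC mulKf.
by field; rewrite !q0.
Qed.

Lemma inf_qprod_bounds d k :
  qprod d k * (1 - x ^+ (d + k)) <= (inf_qprod p d.+1 : R) <= qprod d k.
Proof.
set u := fun N => \prod_(d.+1 <= i < N) (1 - p%:R ^- i) : R.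
have uS N : (d < N)%N -> u N = qprod d (N - d.+1).
  move=> dN; rewrite /u -{1}[d.+1]add0n big_addn big_mkord; apply: eq_bigr => i _.
  by rewrite -exprVn addnC addSn.
have u1 N : (N <= d.+1)%N -> u N = 1 by move=> h; rewrite /u big_geq.
have qle l l' : (l <= l')%N -> qprod d l' <= qprod d l.
  move=> h; rewrite -(subnKC h) qprodD ler_piMr ?qprod_le1 //.
  exact/ltW/qprod_gt0.
have mono : {homo u : n m / (n <= m)%N >-> m <= n}.
  move=> a b ab; have [ha|ha] := leqP a d.
    rewrite (u1 a) ?leqW //; have [hb|hb] := leqP b d; first by rewrite u1 ?leqW.
    by rewrite uS // qprod_le1.
  by rewrite !uS ?(leq_trans ha ab) // qle // leq_sub2r.
have ub N : 0 <= u N.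
  have [h|h] := leqP N d; first by rewrite u1 ?leqW.
  by rewrite uS // ltW // qprod_gt0.
have cu : cvgn u.
  by apply: nonincreasing_is_cvgn => //; exists 0 => _ [N _ <-].
apply/andP; split; last first.
  have := nonincreasing_cvgn_ge mono cu (d.+1 + k); rewrite uS ?addKn //.
  by rewrite addSn ltnS leq_addr.
apply: limr_ge => //; near=> N.
have hN : (d.+1 + k <= N)%N by near: N; exact: nbhs_infty_ge.
rewrite -/(u N) uS; last by apply: leq_trans hN; rewrite addSn ltnS leq_addr.
have -> : (N - d.+1 = k + (N - (d.+1 + k)))%N by lia.
rewrite qprodD ler_wpM2l ?(ltW (qprod_gt0 _ _)) //.
apply: le_trans (qprod_ge _ _); rewrite lerDl ltW // invpX_gt0.
Unshelve. all: by end_near.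
Qed.

(** The common prefactor is at most 1 by [qprod0_ge], and with k = r - d the remaining factors both
    lie between (1 - x^k) [qprod d k] and [qprod d k]. *)
Lemma ideal_limit d r : (d <= r)%N ->
  `|ideal R p d r (r - d) - limit_corank_prob p d| <= x ^+ (r - d).
Proof.
move=> dr; rewrite ideal_qprod // /limit_corank_prob.
have -> : \prod_(1 <= i < d.+1) (1 - p%:R ^- i) = qprod 0 d :> R.
  by rewrite big_add1 big_mkord; apply: eq_bigr => i _; rewrite exprVn.
rewrite -exprVn; set k := (r - d)%N.
have := inf_qprod_bounds d k; set L := inf_qprod _ _ => hL.
have -> : x ^+ (d ^ 2) * (qprod d k * qprod k d / qprod 0 d) - x ^+ (d ^ 2) * (L / qprod 0 d)
  = (x ^+ (d ^ 2) / qprod 0 d) * (qprod d k * qprod k d - L) by ring.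
rewrite normrM -[leRHS]mul1r; apply: ler_pM => //.
  rewrite ger0_norm ?divr_ge0 ?(ltW (invpX_gt0 _)) ?(ltW (qprod_gt0 _ _)) //.
  rewrite ler_pdivrMr ?qprod_gt0 // mul1r; apply: le_trans (qprod0_ge d).
  by rewrite ler_wiXn2l ?(ltW invp_gt0) //; [have := invp_le; lra|case: (d) => // ?; rewrite -mulnn leq_pmulr].
have h1 := qprod_ge k d; have h2 := qprod_le1 k d; have h3 := qprod_gt0 d k; have h4 := qprod_le1 d k.
have h5 := invpX_gt0 (k + d); have h6 := invpX_gt0 k.
have h7 : x ^+ (d + k) <= x ^+ k.
  by rewrite exprD ler_piMl ?(ltW h6) // invpX_le1.
rewrite ler_norml; move: hL h1 h2 h3 h4 h5 h6 h7.
set a := qprod d k; set b := qprod k d; set u := x ^+ k; set v := x ^+ (d + k); set w := x ^+ (k + d).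
by nra.
Qed.

End QProducts.

(** * The law of the random matrix *)

Section Law.
Variables (R : realType) (p : nat).

Definition pmf d (T : measurableType d) (P : probability T R)
    (xi : {RV P >-> 'F_p}) (a : 'F_p) : R :=
  fine (P [set t | xi t = a]).

Lemma measurable_Fp (B : set 'F_p) : measurable B.
Proof. by []. Qed.

Variables (d0 : measure_display) (T0 : measurableType d0) (P0 : probability T0 R).
Variable xi : {RV P0 >-> 'F_p}.

Lemma measurable_event d (T : measurableType d) (P : probability T R)
  (X : {RV P >-> 'F_p}) (B : set 'F_p) : measurable (X @^-1` B).
Proof. by rewrite -[_ @^-1` _]setTI; apply: measurable_funP. Qed.

Lemma pmfE a : P0 [set t | xi t = a] = (pmf xi a)%:E.
Proof.
rewrite fineK // fin_num_measure //.
exact: (measurable_event xi [set a]).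
Qed.

Lemma pmf_ge0 a : 0 <= pmf xi a.
Proof. by rewrite fine_ge0. Qed.

Lemma prob_finite_sum d (T : measurableType d) (P : probability T R) (I : finType)
    (f : T -> I) (Q : pred I) : (forall i, measurable (f @^-1` [set i])) ->
  P [set t | Q (f t)] = (\sum_(i | Q i) P (f @^-1` [set i]))%E.
Proof.
move=> mf.
have -> : [set t | Q (f t)] = \bigcup_(i in [set: I]) (if Q i then f @^-1` [set i] else set0).
  apply/seteqP; split => t /=.
    by move=> Qt; exists (f t) => //; rewrite Qt.
  by move=> [i _]; case: ifP => // Qi /= ->.
rewrite measure_fin_bigcup //.
- rewrite (fsbigE (index_enum I)) ?index_enum_uniq //; last first.
    by move=> i _; rewrite mem_index_enum.
  rewrite [RHS]big_mkcond; apply: eq_big => [i|i _]; first by rewrite in_setT.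
  by case: ifP => // _; rewrite measure0.
- exact: finite_finset.
- move=> i j _ _ [t []]; case: ifP => // _ /= <-.
  by case: ifP => // _ /= <-.
- by move=> i _; case: ifP.
Qed.

Lemma pmf_sum1 : \sum_a pmf xi a = 1.
Proof.
apply: EFin_inj; rewrite -sumEFin.
under eq_bigr do rewrite -pmfE.
rewrite -(prob_finite_sum P0 xpredT (f := xi)); last by move=> i; apply: measurable_event.
by rewrite -(probability_setT P0); congr (P0 _); apply/seteqP; split.
Qed.

Lemma pmf_le alpha : balanced alpha xi -> forall a, pmf xi a <= 1 - alpha.
Proof.
move=> h a; rewrite -lee_fin -pmfE; apply: le_trans h.
exact: (le_bigmax _ (fun a => P0 [set t | xi t = a])).
Qed.

(** The difference is taken in the integers, so the event is empty when k > n, in agreement with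
    [\rank A + k == n]. *)
Lemma rank_prob_law d (T : measurableType d) (P : probability T R) n
    (M : 'I_n * 'I_n -> {RV P >-> 'F_p}) k : iid_copies M xi ->
  fine (P [set t | (\rank (\matrix_(i < n, j < n) M (i, j) t))%:Z = n%:Z - k%:Z])
  = \sum_(A : 'M['F_p]_(n, n)) mweight (pmf xi) A * (\rank A + k == n)%N%:R.
Proof.
move=> [ind idd].
pose f t : 'M['F_p]_(n, n) := \matrix_(i < n, j < n) M (i, j) t.
have fE A : f @^-1` [set A] = \bigcap_(ij in [set` finset.setT]) M ij @^-1` [set A ij.1 ij.2].
  apply/seteqP; split => t /=.
    by move=> <- [i j] _ /=; rewrite mxE.
  by move=> h; apply/matrixP => i j; rewrite mxE; apply: (h (i, j)); rewrite /= inE.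
have PE A : P (f @^-1` [set A]) = (mweight (pmf xi) A)%:E.
  rewrite fE ind; last by move=> i; apply: measurable_Fp.
  rewrite /mweight /rweight pair_bigA /= -prodEFin.
  apply: eq_big => [ij|ij _]; first by rewrite inE.
  rewrite mxE -pmfE; have := idd ij [set A ij.1 ij.2] (measurable_Fp _).
  by rewrite /distribution /pushforward /=.
have -> : [set t | (\rank (\matrix_(i < n, j < n) M (i, j) t))%:Z = n%:Z - k%:Z]
   = [set t | \rank (f t) + k == n].
  by apply/seteqP; split => t /=; rewrite -/(f t) => h; [apply/eqP|move/eqP: h]; lia.
rewrite (prob_finite_sum P (fun A : 'M['F_p]_(n, n) => \rank A + k == n)%N) => [|A].
  under eq_bigr do rewrite PE.
  rewrite sumEFin /= big_mkcond; apply: eq_bigr => A _.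
  by case: ifP => _; rewrite ?mulr1 ?mulr0.
rewrite fE; apply: fin_bigcap_measurable => [|ij _]; last exact: measurable_event.
exact: finite_finset.
Qed.

End Law.

(** * The error term *)

Section Bound.
Variables (R : realType) (alpha a : R) (i : nat).
Hypothesis alpha_gt0 : 0 < alpha.
Hypothesis alpha_le1 : alpha <= 1.
Hypothesis a_ge0 : 0 <= a.
Hypothesis i_large : 128 <= 2 ^+ i * alpha ^+ 2.

(** Then exp (- m / 2) = exp (- 2 L) exp (- a L): the second factor pays for the dimension, the
    first for p or for [codim]. *)
Definition level_factor : R := 4 + 2 * a.
(** The constant 24 makes [laziness * alpha * codim / 4] at least 3 L, as [expRN3_le] requires. *)
Definition codim_factor : R := 24 * 16 ^+ i * level_factor / alpha.
Definition growth_factor : R := (codim_factor + 1) * (2 + 4 / alpha).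

Lemma level_factor_ge4 : 4 <= level_factor. Proof. by have := a_ge0; rewrite /level_factor; lra. Qed.

Lemma pow16_ge1 : 1 <= 16 ^+ i :> R. Proof. by apply: exprn_ege1; lra. Qed.

Lemma codim_factor_ge : 96 <= codim_factor.
Proof.
have a1 := alpha_le1; rewrite /codim_factor ler_pdivlMr //.
have : 4 <= 16 ^+ i * level_factor by have := level_factor_ge4; have := pow16_ge1; nra.
by lra.
Qed.

Lemma pow_le_expRN (x L : R) k : 0 <= x <= 2^-1 -> 2 * L <= k%:R ->
  x ^+ k <= expR (- L).
Proof.
move=> /andP[x0 x2] hk; apply: (@le_trans _ _ (expR (- 2^-1) ^+ k)).
  rewrite lerXn2r ?nnegrE ?expR_ge0 //; apply: le_trans (expR_ge1Dx _).
  by lra.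
by rewrite -expRM_natl ler_expR; lra.
Qed.

Lemma sqr_mul_expRN_le (L : R) : 0 <= L -> L ^+ 2 * expR (- L) <= 4.
Proof.
move=> L0; have h1 := expR_ge1Dx (L / 2).
have h3 : expR L = expR (L / 2) * expR (L / 2) by rewrite -expRD; congr expR; field.
by rewrite expRN ler_pdivrMr ?expR_gt0 // h3; set E := expR (L / 2) in h1 *; nra.
Qed.

Lemma expRN3_le (L y : R) : 1 <= L -> 0 < y <= expR L ->
  expR (- (3 * L)) <= (4 * y)^-1.
Proof.
move=> L1 /andP[y0 yL]; rewrite expRN lef_pV2 ?posrE ?expR_gt0 ?mulr_gt0 //.
have -> : 3 * L = L + L + L by ring.
rewrite 2!expRD; apply: ler_pM => //; first by rewrite ltW.
by have := expR_ge1Dx L; set E := expR L => h; nra.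
Qed.

Lemma eps_large : 32 / (2 ^+ i * alpha) <= alpha / 4.
Proof.
rewrite ler_pdivrMr ?mulr_gt0 ?exprn_gt0 //.
by have := i_large; lra.
Qed.

Section Scale.
Variable L : R.
Hypothesis L_ge1 : 1 <= L.

Local Notation m := (level_factor * L).

(* The number of rows that are left out when the first rows are required to be
   independent and to have no structured vector in their orthogonal. *)
Definition codim : nat := (Num.truncn (codim_factor * L ^+ 2)).+1.

Local Notation s := codim.

Lemma codim_gt : codim_factor * L ^+ 2 < s%:R.
Proof. exact: truncnS_gt. Qed.

Lemma codim_le : s%:R <= (codim_factor + 1) * L ^+ 2.
Proof.
have L1 := L_ge1; have B96 := codim_factor_ge.
have /truncn_itv/andP[h _] : 0 <= codim_factor * L ^+ 2 by nra.
by rewrite /codim -natr1; nra.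
Qed.

Lemma codim_ge : 96 * L <= s%:R.
Proof. by have := L_ge1; have := codim_factor_ge; have := codim_gt; nra. Qed.

(** The first term bounds the exponent of (4 p / alpha)^s; the second is the decay lost when the
    dimension drops by [s]. *)
Lemma codim_exponent_le : s%:R * (L + 4 / alpha) + alpha * s%:R / 4 <= growth_factor * L ^+ 3.
Proof.
have L1 := L_ge1; have a1 := alpha_le1; have a0 := alpha_gt0.
have : 0 < alpha^-1 by rewrite invr_gt0.
have -> : s%:R * (L + 4 / alpha) + alpha * s%:R / 4 = s%:R * (L + 4 / alpha + alpha / 4) by ring.
have -> : growth_factor * L ^+ 3 = ((codim_factor + 1) * L ^+ 2) * ((2 + 4 / alpha) * L) by rewrite /growth_factor; ring.
move=> v0; apply: ler_pM; [by [] | | exact: codim_le | ];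
  by move: v0; set v := alpha^-1; nra.
Qed.

Lemma codim_le_dim n : (growth_factor + 1) * L ^+ 3 <= alpha * n%:R / 4 -> (s <= n)%N.
Proof.
have L1 := L_ge1; have a1 := alpha_le1; have a0 := alpha_gt0.
have h := codim_exponent_le; rewrite -(ler_nat R) => star.
have v0 : 0 <= s%:R * (4 / alpha) by rewrite mulr_ge0 // divr_ge0 // ltW.
have : 0 <= n%:R :> R by rewrite ler0n.
have : 0 <= s%:R :> R by rewrite ler0n.
have : 0 <= L ^+ 3 by rewrite exprn_ge0 //; lra.
by nra.
Qed.

Lemma level_half : m / 2 = 2 * L + a * L.
Proof. by rewrite /level_factor; field. Qed.

Lemma level_ge1 : 1 <= m.
Proof. by have := L_ge1; have := level_factor_ge4; nra. Qed.

Lemma expR_level_le : expR (- (m / 2)) <= expR (- L) * expR (- L).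
Proof. by rewrite -expRD ler_expR level_half; have := L_ge1; have := a_ge0; nra. Qed.

Lemma radius_lt : radius i m < s%:R * alpha.
Proof.
apply: (@lt_trans _ _ (codim_factor * L ^+ 2 * alpha)); last by rewrite ltr_pM2r // codim_gt.
have -> : codim_factor * L ^+ 2 * alpha = 24 * (16 ^+ i * m) * L.
  by rewrite /codim_factor; field; rewrite gt_eqF.
rewrite /radius; have : 1 <= 16 ^+ i * m by rewrite mulr_ege1 ?pow16_ge1 ?level_ge1.
by have := L_ge1; set X := 16 ^+ i * m; nra.
Qed.

Lemma laziness_bound (y : R) : 0 < y <= expR L ->
  expR (- (laziness i m * alpha * s%:R / 4)) <= (4 * y)^-1.
Proof.
move=> hy; apply: le_trans (expRN3_le L_ge1 hy).
have m1 := level_ge1; have h16 := pow16_ge1.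
have K0 : 0 < level_factor by apply: lt_le_trans level_factor_ge4.
have L0 : 0 < L by apply: lt_le_trans L_ge1.
rewrite ler_expR lerN2.
have -> : 3 * L = laziness i m * alpha * (codim_factor * L ^+ 2) / 4.
  rewrite /laziness /radius /codim_factor; field.
  by rewrite (gt_eqF alpha_gt0) (gt_eqF K0) (gt_eqF L0) gt_eqF ?exprn_gt0.
rewrite ler_pM2r ?invr_gt0 // ler_wpM2l ?(ltW codim_gt) // mulr_ge0 ?(ltW alpha_gt0) //.
by rewrite /laziness invr_ge0 /radius !mulr_ge0 ?exprn_ge0 // ltW.
Qed.

Lemma structured_bound (y : R) n N : 0 < y <= expR L ->
  (growth_factor + 1) * L ^+ 3 <= alpha * n%:R / 4 -> (n - s <= N)%N ->
  (y / (alpha / 4)) ^+ s * (alpha / 4 + (1 - alpha / 2)) ^+ N <= expR (- L).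
Proof.
move=> /andP[y0 yL] star hN.
have a1 := alpha_le1; have a0 := alpha_gt0.
have h1 : (y / (alpha / 4)) ^+ s <= expR (s%:R * (L + 4 / alpha)).
  rewrite expRM_natl lerXn2r ?nnegrE ?expR_ge0 ?divr_ge0 ?(ltW a0) ?(ltW y0) //.
  rewrite expRD; apply: ler_pM => //; rewrite ?invr_ge0 ?divr_ge0 ?(ltW a0) ?(ltW y0) //.
  by rewrite invf_div; have := expR_ge1Dx (4 / alpha); lra.
have baseE : alpha / 4 + (1 - alpha / 2) = 1 - alpha / 4 by field.
have h2 : (alpha / 4 + (1 - alpha / 2)) ^+ N <= expR (N%:R * (- (alpha / 4))).
  rewrite expRM_natl baseE lerXn2r ?nnegrE ?expR_ge0 //; first lra.
  exact: expR_ge1Dx.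
apply: le_trans (ler_pM _ _ h1 h2) _; rewrite ?exprn_ge0 ?divr_ge0 ?(ltW a0) ?(ltW y0) //.
  by rewrite baseE; lra.
rewrite -expRD ler_expR.
have hN' : n%:R - s%:R <= N%:R :> R by rewrite lerBlDr -natrD ler_nat addnC -leq_subLR.
have : alpha * (n%:R - s%:R) <= alpha * N%:R by rewrite ler_pM2l.
have : L <= L ^+ 3 by rewrite -[leLHS]expr1 ler_weXn2l.
by move: codim_exponent_le star; lra.
Qed.

Lemma codim_mul_level_le : s%:R * expR (- (m / 2)) <= 4 * (codim_factor + 1) * expR (- L).
Proof.
have e0 := expR_ge0 (- L); have B96 := codim_factor_ge.
have e4 : L ^+ 2 * expR (- L) <= 4 by rewrite sqr_mul_expRN_le // (le_trans ler01).
apply: (@le_trans _ _ ((codim_factor + 1) * L ^+ 2 * (expR (- L) * expR (- L)))).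
  by rewrite ler_pM ?expR_ge0 ?codim_le ?expR_level_le.
have -> : (codim_factor + 1) * L ^+ 2 * (expR (- L) * expR (- L)) =
  (codim_factor + 1) * ((L ^+ 2 * expR (- L)) * expR (- L)) by ring.
have -> : 4 * (codim_factor + 1) * expR (- L) = (codim_factor + 1) * (4 * expR (- L)) by ring.
by rewrite ler_wpM2l ?ler_wpM2r //; lra.
Qed.

End Scale.

Lemma rank_prob_bound (n d p : nat) (mu : 'F_p -> R) (L : R) :
  prime p -> (forall x, 0 <= mu x) -> \sum_x mu x = 1 ->
  \sum_x mu x ^+ 2 <= 1 - alpha ->
  1 <= L -> n%:R <= expR (a * L) -> p%:R <= expR L -> d%:R <= L ->
  (growth_factor + 1) * L ^+ 3 <= alpha * n%:R / 4 ->
  `|\sum_(A : 'M['F_p]_(n, n)) mweight mu A * (\rank A + d == n)%N%:R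
    - limit_corank_prob p d| <= (4 * (codim_factor + 1) + 3 + expR 1) * expR (- L).
Proof.
move=> p_pr mu0 mu1 mu2 L1 nL pL dL star.
have [chi [chiD chiN chiS]] := exists_character R p_pr.
pose s := codim L; pose m := level_factor * L; pose N := (n - s)%N; pose delta := expR (- (m / 2)).
have sn : (s <= n)%N by apply: codim_le_dim.
have p0 : 0 < p%:R :> R by rewrite ltr0n prime_gt0.
have d0 : 0 <= delta := expR_ge0 _.
have p_pL : 0 < (p%:R : R) <= expR L by apply/andP; split.
have p_le : p%:R <= expR (m / 2).
  apply: (le_trans pL); rewrite ler_expR /m level_half.
  by move: a_ge0 L1; nra.
have eps_le : alpha / 4 <= 1 - alpha / 2 by move: alpha_le1; lra.
have pV : 0 <= (p%:R^-1 : R) <= 2^-1 by rewrite invp_le // invr_ge0 ler0n.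
(* Used twice: for vectors of length [n] against the first [n - s] rows, and for vectors of length
   [n - s] against the [n] columns. *)
have structured_le k N' : (k <= N' + s)%N -> (n - s <= k)%N ->
    \sum_(F : 'rV['F_p]_k | (F != 0) && structured chi mu m F) orth_prob mu F ^+ N' <= expR (- L).
  move=> h1 h2; apply: le_trans (structured_bound L1 p_pL star h2).
  exact: (structured_sum p_pr chiD chiN chiS mu0 mu1 alpha_gt0 mu2 (level_ge1 L1) p_le
    (radius_lt L1) (laziness_bound L1 p_pL) eps_large eps_le h1).
have T2 : \sum_(F : 'rV['F_p]_n | (F != 0) && structured chi mu m F) orth_prob mu F ^+ N <= expR (- L).
  by apply: structured_le; rewrite ?leq_subr // /N subnK.
have {structured_le}T3 : \sum_(y : 'rV['F_p]_N | y != 0) orth_prob mu y ^+ n <= (1 + expR 1) * expR (- L).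
  rewrite (bigID (structured chi mu m)) /= mulrDl mul1r; apply: lerD.
    by apply: structured_le => //; rewrite (leq_trans (leq_subr _ _)) // leq_addr.
  (* Unstructured [y] are simply counted: p^N (1/p + delta)^n = p^(-s) (1 + p delta)^n, and n p
     delta is at most 1. *)
  apply: (@le_trans _ _ (\sum_(y : 'rV['F_p]_N) (p%:R^-1 + delta) ^+ n)).
    rewrite big_mkcond; apply: ler_sum => y _; case: ifP => [/andP[_ yb]|_].
      rewrite lerXn2r ?nnegrE ?orth_prob_ge0 ?addr_ge0 ?invr_ge0 ?ler0n //.
      exact: (orth_prob_unstructured p_pr chiD chiN chiS).
    by rewrite exprn_ge0 // addr_ge0 ?invr_ge0 ?ler0n.
  rewrite sumr_const card_mx card_Fp // mul1n -[_ *+ _]mulr_natl natrX.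
  have -> : p%:R^-1 + delta = p%:R^-1 * (1 + p%:R * delta).
    by rewrite mulrDr mulr1 mulKf // gt_eqF.
  have -> : p%:R ^+ N * (p%:R^-1 * (1 + p%:R * delta)) ^+ n =
     p%:R^-1 ^+ s * (1 + p%:R * delta) ^+ n.
    rewrite exprMn mulrA -[in p%:R^-1 ^+ n](subnK sn) exprD mulrA -exprMn.
    by rewrite mulfV ?gt_eqF // expr1n mul1r.
  have pd0 : 0 <= p%:R * delta by rewrite mulr_ge0 ?ler0n.
  rewrite mulrC; apply: ler_pM; rewrite ?exprn_ge0 ?addr_ge0 ?invr_ge0 ?ler0n //.
    apply: (@le_trans _ _ (expR (p%:R * delta) ^+ n)).
      by rewrite lerXn2r ?nnegrE ?expR_ge0 ?addr_ge0 ?expR_ge1Dx.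
    rewrite -expRM_natl ler_expR.
    apply: (@le_trans _ _ (expR (a * L) * (expR L * delta))).
      by rewrite !ler_pM ?ler0n // ler_wpM2r.
    rewrite -!expRD -[leRHS]expR0 ler_expR /m level_half.
    by move: L1; lra.
  apply: pow_le_expRN => //; apply: le_trans (codim_ge L1).
  by move: L1; lra.
have ds : (d <= s)%N.
  rewrite -(ler_nat R) (le_trans dL) // (le_trans _ (codim_ge L1)) //.
  by move: L1; lra.
have T4 : `|ideal R p d s (s - d) - limit_corank_prob p d| <= expR (- L).
  apply: le_trans (ideal_limit R p_pr ds) _.
  apply: pow_le_expRN => //; rewrite natrB //.
  by have := codim_ge L1; rewrite -/s; lra.
set S := \sum_A _; set I := ideal R p d s (s - d) in T4.
have hS : `|S - I| <= s%:R * delta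
    + \sum_(F : 'rV['F_p]_n | (F != 0) && structured chi mu m F) orth_prob mu F ^+ N
    + \sum_(y : 'rV['F_p]_N | y != 0) orth_prob mu y ^+ n.
  have := rank_prob_approx p_pr chiD chiN chiS mu0 mu1 m N ds.
  by rewrite /N (subnK sn).
have T1 : s%:R * delta <= 4 * (codim_factor + 1) * expR (- L) by apply: codim_mul_level_le.
have -> : S - limit_corank_prob p d = (S - I) + (I - limit_corank_prob p d) by ring.
apply: le_trans (ler_normD _ _) _.
by move: T1 T2 T3 T4 hS; lra.
Qed.

End Bound.

(** * The choice of the constants *)

Unset Implicit Arguments.

Theorem theorem1p4 (R : realType) (alpha : R) (halpha : 0 < alpha) :
  exists2 c0 : R, 0 < c0 &
  forall c : R, 0 < c -> c < c0 ->
  exists2 c' : R, 0 < c' &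
  exists C : R,
  forall (n d p : nat),
    (1 <= n)%N ->
    d%:R <= n%:R `^ c ->
    prime p ->
    p%:R <= expR (n%:R `^ c) ->
  forall (disp0 : measure_display) (T0 : measurableType disp0)
         (P0 : probability T0 R) (xi : {RV P0 >-> 'F_p}),
    balanced alpha xi ->
  forall (disp : measure_display) (T : measurableType disp)
         (P : probability T R) (M : 'I_n * 'I_n -> {RV P >-> 'F_p}),
    iid_copies M xi ->
  `| fine (P [set t | (\rank (\matrix_(i < n, j < n) M (i, j) t))%:Z
                      = n%:Z - d%:Z])
     - limit_corank_prob p d |
    <= C * expR (- (n%:R `^ c')).
Proof.
(* With c < 1/4 and L = n^c, L^4 is at most n, so the cubic condition of [rank_prob_bound] can fail
   only for bounded L; the rate is c' = c. *)
exists 4^-1; first by rewrite invr_gt0.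
move=> c c0 c4; exists c => //.
have [i hi] : exists i : nat, 128 <= 2 ^+ i * alpha ^+ 2.
  exists (Num.truncn (128 / alpha ^+ 2)).+1.
  rewrite -ler_pdivrMr ?exprn_gt0 //; apply: ltW.
  apply: lt_le_trans (truncnS_gt _) _.
  by rewrite -natrX ler_nat ltnW // ltn_expl.
have a0 : 0 <= c^-1 by rewrite invr_ge0 ltW.
pose Bc := codim_factor alpha c^-1 i; pose Hc := growth_factor alpha c^-1 i.
pose C1 := 4 * (Bc + 1) + 3 + expR 1.
pose Z := 4 * (Hc + 1) / alpha.
(* The second summand covers the bounded range L <= Z, where the trivial bound 2 is used. *)
exists (C1 + 2 * expR Z).
move=> n d p n1 dL p_pr pL disp0 T0 P0 xi bal disp T P M iid.
rewrite (rank_prob_law d iid).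
set L := n%:R `^ c in dL pL *.
have mu0 := pmf_ge0 xi; have mu1 := pmf_sum1 xi.
(* The sum of the squares is at most the largest mass. *)
have mu2 : \sum_x pmf xi x ^+ 2 <= 1 - alpha.
  rewrite -[leRHS]mulr1 -[X in _ <= _ * X]mu1 mulr_sumr; apply: ler_sum => x _.
  by rewrite expr2 ler_wpM2r //; apply: pmf_le.
have n1R : 1 <= n%:R :> R by rewrite ler1n.
have L1 : 1 <= L by rewrite -(powRr0 n%:R) ler_powR // ltW.
(* This is ln y <= y at y = n^c, and the reason for a = 1 / c. *)
have nL : n%:R <= expR (c^-1 * L).
  rewrite -[leLHS]lnK ?posrE ?(lt_le_trans ltr01) // ler_expR.
  rewrite -ler_pdivrMl ?invr_gt0 // invrK -ln_powR.
  by apply/ltW/ln_sublinear; rewrite (lt_le_trans ltr01).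
have L4 : L ^+ 4 <= n%:R.
  rewrite -powR_mulrn ?powR_ge0 // -powRrM -[leRHS]powRr1 ?ler0n //.
  by rewrite ler_powR //; lra.
have eL := expR_ge0 (- L).
have al1 : alpha <= 1 by apply: (alpha_le1 mu2).
have B96 : 96 <= Bc by apply: codim_factor_ge.
have C1_ge0 : 0 <= C1 by have := expR_ge0 (1 : R); rewrite /C1; lra.
have [star|nstar] := lerP ((Hc + 1) * L ^+ 3) (alpha * n%:R / 4).
  have := rank_prob_bound halpha al1 a0 hi p_pr mu0 mu1 mu2 L1 nL pL dL star.
  rewrite -/Bc -/C1 => h; apply: (le_trans h).
  by rewrite ler_wpM2r // lerDl mulr_ge0 // expR_ge0.
have LZ : L <= Z.
  rewrite /Z ler_pdivlMr //.
  have L3 : 0 < L ^+ 3 by rewrite exprn_gt0 //; lra.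
  rewrite -(ler_pM2r L3).
  have : alpha * L ^+ 4 <= alpha * n%:R by rewrite ler_pM2l.
  rewrite exprS; move: nstar; set X := L ^+ 3; nra.
have h2 : 2 <= 2 * expR Z * expR (- L).
  rewrite -mulrA ler_peMr // -expRD -[leLHS]expR0 ler_expR; lra.
apply: (@le_trans _ _ 2); last first.
  by rewrite mulrDl; have := mulr_ge0 C1_ge0 eL; lra.
set S := \sum_A _; set lim := limit_corank_prob _ _.
have S01 : 0 <= S <= 1.
  rewrite sumr_ge0 /=; last by move=> A _; rewrite mulr_ge0 ?mweight_ge0.
  rewrite -(mweight_sum mu1 n n); apply: ler_sum => A _.
  by rewrite ler_piMr ?mweight_ge0 // lern1 leq_b1.
(* At r = d the limit is within 1 of a number in [0, 1], hence within 2 of [S]. *)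
have := ideal_limit R p_pr (leqnn d); rewrite subnn expr0 -/lim.
have := ideal01 R p_pr d d 0.
rewrite !ler_norml; set I := ideal _ _ _ _ _; lra.
Qed.
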